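(* Input: a degree $d$ and a branching pattern, that is, three collections of branching orders, such that (a) the branching orders in the same collection (fiber) sum up to $d$, and there are $d+2$ branching orders in total; (b) one of the three collections prescribes only branching orders $2$ and at most one unramified (i.e. simple, not branching) point. Output: all Belyi functions (up to fractional-linear transformations) whose coverings $\varphi:\mathbb{P}^1\to\mathbb{P}^1$ branch only above the set $\Delta=\{0,1,\infty\}$ with the given branching orders. The following algorithm with this input and output is correct. Step 1. Prescribe the branching orders mentioned in assumption (b) to the fiber of the point $z=1$, and prescribe the other two collections to the fibers of $z=0$ and $z=\infty$. Choose the points $x=0$, $x=1$, $x=\infty$ above $\Delta$ in a convenient way: if an unramified point is prescribed above $z=1$, choose it to be $x=\infty$ (see also the remarks in the context). Consider the other points above $z=0$ and $z=\infty$ as unknown. Accordingly, write $\varphi(x)=K\,P(x)/Q(x)$, where $K$ is an undetermined constant, and $P(x)$, $Q(x)$ are monic polynomials in the square-free factorized form (following the branching pattern) with some undetermined coefficients. Step 2. Compute the pull-back $\varphi'(x)\,dx/\varphi(x)$ of the differential $dz/z$. Let $R(x)$ be the numerator of $\varphi'(x)/\varphi(x)$. The roots of $R(x)$ are the branching points above $z=1$. Step 3. Let $\widetilde{\varphi}(x)=R(x)^2/Q(x)$ and compute the rational function $\Phi(x)=\widetilde{\varphi}\,'(x)/\widetilde{\varphi}(x)$. The numerator of $\Phi(x)$ has the same roots as the polynomial $P(x)$, but their multiplicity is $1$ less than in $P(x)$. This gives a set of algebraic equations in the undetermined coefficients. Step 4. Solve the algebraic equations obtained in Step 3 by Gröbner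 basis methods, and find possible pairs of polynomials $P(x),Q(x)$ with the right factorization pattern. For each non-degenerate solution, the constant $K$ in the target $\varphi(x)=K\,P(x)/Q(x)$ is such that the function $1-K\,P(x)/Q(x)$ is proportional to $\widetilde{\varphi}(x)$. If necessary, compose the output functions $\varphi(x)$ with suitable fractional-linear transformations to move some $x$-points (or even $z$-points) to final desired locations. The correctness holds because Step 3 produces enough algebraic equations between the undetermined coefficients: the restrictions on the polynomials $P(x),Q(x),R(x)$ and the denominator of $\Phi(x)$ determine the desired branching pattern for $\varphi(x)$.
   Context: A covering $\varphi:\mathbb{P}^1\to\mathbb{P}^1$ of degree $d$ is given by a rational function $z=\varphi(x)$, where $x$ and $z$ are rational parameters on the upper and lower projective lines. The branching orders in a fiber of $\varphi$ are the ramification indices of the points in that fiber. A Belyi function is a rational function with at most three critical values, i.e. one whose covering branches only above a set of three points. Remarks on the choice of $x=0$, $x=1$, $x=\infty$ in Step 1: in general, a good strategy is to choose points which have different branching orders than most points in the same fiber. On the other hand, the algorithm can be more effective if points with maximal branching orders are chosen as $x=0$, $x=1$, $x=\infty$; with this modification the function $\widetilde{\varphi}(x)$ in Step 3 may acquire an extra linear factor. It may also be convenient not to make a choice for $x=1$; then there is an extra variable and the algebraic equations are weighted-homogeneous (with respect to the transformations $x\mapsto\alpha x$). *)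

(* Defs.v *)
From HB Require Import structures.
From mathcomp Require Import all_boot all_order all_algebra.
From mathcomp Require Import generic_quotient separable mpoly.

Set Implicit Arguments.
Unset Strict Implicit.
Unset Printing Implicit Defensive.

Import GRing.Theory.
Local Open Scope ring_scope.

Notation "p %:F" := (tofrac p) : ring_scope.

(* The projective line over C is [option C], with [None] as the point at      *)
(* infinity. The set {0, 1, oo} is indexed by [option bool]; [pt] is its      *)
(* embedding into the projective line.                                        *)
Definition Delta := option bool.
Definition z0 : Delta := Some false.
Definition z1 : Delta := Some true.
Definition zoo : Delta := None.

Section RationalFunctions.
Variable C : fieldType.
Implicit Types (f : {fraction {poly C}}) (x y : option C).

Definition pt (z : Delta) : option C := omap (fun b : bool => b%:R) z.

(* numerator and denominator in lowest terms, each defined up to a constant *)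
Definition fnum f : {poly C} := let r := repr f in \n_r %/ gcdp \n_r \d_r.
Definition fden f : {poly C} := let r := repr f in \d_r %/ gcdp \n_r \d_r.

Definition fdeg f : nat := (maxn (size (fnum f)) (size (fden f))).-1.

(* At infinity, numerator and denominator are evaluated as binary forms of    *)
(* degree [fdeg f], i.e., by taking the coefficient of 'X^(fdeg f).           *)
Definition feval f x : option C :=
  let: (a, b) := if x is Some t then ((fnum f).[t], (fden f).[t])
                 else ((fnum f)`_(fdeg f), (fden f)`_(fdeg f)) in
  if b == 0 then None else Some (a / b).

Definition fiber_poly f y : {poly C} :=
  if y is Some t then fnum f - t *: fden f else fden f.

(* Ramification index: the multiplicity of x as a root of the form of degree  *)
(* [fdeg f] that defines the fiber through x. It is relevant for nonconstant  *)
(* f only.                                                                    *)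
Definition ramidx f x : nat :=
  let g := fiber_poly f (feval f x) in
  if x is Some t then mup t g else (fdeg f - (size g).-1)%N.

Definition fiber_orders f y (l : seq nat) : Prop :=
  exists xs : seq (option C),
    [/\ uniq xs,
        forall x, (x \in xs) = (feval f x == y)
      & perm_eq [seq ramidx f x | x <- xs] l].

Definition belyi_with_orders (d : nat) (b : Delta -> seq nat) f : Prop :=
  [/\ fdeg f = d,
      forall x, (1 < ramidx f x)%N -> exists z : Delta, feval f x = pt z
    & forall z : Delta, fiber_orders f (pt z) (b z)].

Definition mobius f : Prop := fdeg f = 1%N.

Definition fderiv f : {fraction {poly C}} :=
  ((fnum f)^`() * fden f - fnum f * (fden f)^`())%:F / (fden f ^+ 2)%:F.

Definition is_numerator f (p : {poly C}) : Prop :=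
  exists q : {poly C}, coprimep p q /\ f = p%:F / q%:F.

Definition proportional f g : Prop :=
  exists2 a : C, a != 0 & f = (a%:P)%:F * g.

End RationalFunctions.

(* A collection of type (b): orders 2 and at most one order 1. *)
Definition two_or_one_pattern (l : seq nat) : bool :=
  all (fun k => (k == 1%N) || (k == 2)) l && (count_mem 1%N l <= 1)%N.

(* A point of the upper line up to relabelling: the fiber it lies in and its  *)
(* branching order.                                                           *)
Definition point := (Delta * nat)%type.

(* The points chosen as x = 0, x = 1, x = oo; the choice of x = 1 may be      *)
(* omitted.                                                                   *)
Record marking := Marking { at0 : point; at1 : option point; atoo : point }.

Definition marked (mk : marking) : seq point :=
  [:: at0 mk, atoo mk & seq_of_opt (at1 mk)].

Definition finite_marks (A : nzRingType) (mk : marking) : seq (A * point) :=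
  (0, at0 mk) :: [seq (1, p) | p <- seq_of_opt (at1 mk)].

Definition pattern_points (b : Delta -> seq nat) : seq point :=
  [seq (z, k) | z <- [:: z0; z1; zoo], k <- b z].

(* b assigns the collections to the fibers of z = 0, 1, oo. The marked points *)
(* have to be available in the pattern, with multiplicity.                    *)
Definition admissible (b : Delta -> seq nat) (mk : marking) : Prop :=
  [/\ two_or_one_pattern (b z1),
      forall p : point,
        (count_mem p (marked mk) <= count_mem p (pattern_points b))%N
    & 1%N \in b z1 -> atoo mk = (z1, 1%N)].

Definition unknown_points (b : Delta -> seq nat) (mk : marking) : seq point :=
  [seq p <- foldr (fun p s => rem p s) (pattern_points b) (marked mk)
     | p.1 != z1].

(* The numerator of f'/f, for f the product of the g ^ k with (g, k) in fs,   *)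
(* over the common denominator \prod_((g, k) in fs) g.                        *)
Fixpoint dlog_num (A : comNzRingType) (fs : seq ({poly A} * int)) : {poly A} :=
  if fs is (g, k) :: fs' then
    (g^`() *~ k) * (\prod_(h <- fs') h.1) + g * dlog_num fs'
  else 0.

(* The coefficient ring is arbitrary: it is instantiated with polynomials in  *)
(* the undetermined coefficients to form the equations, and with C for the    *)
(* values of P, Q, R, etc. at a solution. There are as many undetermined      *)
(* coefficients as unknown points: those of the monic polynomial whose roots  *)
(* are the unknown points of kind p are the [u i] with the i-th unknown point *)
(* of kind p.                                                                 *)
Section Ansatz.
Variables (A : comNzRingType) (b : Delta -> seq nat) (mk : marking).
Variable u : 'I_(size (unknown_points b mk)) -> A.

Definition unknown_factor (p : point) : {poly A} :=
  Poly (rcons [seq u i | i <- enum 'I_(size (unknown_points b mk))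
                       & tnth (in_tuple (unknown_points b mk)) i == p] 1).

Definition factors (z : Delta) : seq ({poly A} * nat) :=
  [seq (unknown_factor p, p.2) | p <- undup (unknown_points b mk) & p.1 == z]
  ++ [seq ('X - (m.1)%:P, m.2.2) | m <- finite_marks A mk & m.2.1 == z].

Definition full_prod (z : Delta) : {poly A} :=
  \prod_(g <- factors z) g.1 ^+ g.2.

Definition sqfree_prod (z : Delta) : {poly A} := \prod_(g <- factors z) g.1.

Definition polP : {poly A} := full_prod z0.
Definition polQ : {poly A} := full_prod zoo.

Definition inv_factors (z : Delta) : seq ({poly A} * int) :=
  [seq (g.1, - (g.2)%:Z) | g <- factors z].

(* numerator of phi'/phi for phi = K P / Q *)
Definition polR : {poly A} :=
  dlog_num ([seq (g.1, (g.2)%:Z) | g <- factors z0] ++ inv_factors zoo).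

(* numerator of Phi, the logarithmic derivative of R ^ 2 / Q *)
Definition polN : {poly A} := dlog_num ((polR, 2) :: inv_factors zoo).

(* monic, with the roots of P and multiplicities lowered by 1 *)
Definition lowerP : {poly A} := \prod_(g <- factors z0) g.1 ^+ (g.2).-1.

(* The numerator of Phi is a constant multiple of lowerP; the constant is     *)
(* eliminated by comparing the coefficients at the leading term of lowerP.    *)
Definition numerator_equations : seq A :=
  polN - polN`_((size lowerP).-1) *: lowerP.

(* A finite point chosen above z = 1 is a root of R. If infinity is chosen    *)
(* above z = 1 with branching order e then phi'/phi = O(x ^ (- e - 1)) there, *)
(* where the denominator has degree n; hence R has degree < n - e. The        *)
(* coefficients of R above n - e vanish identically for e <= 2.               *)
Definition mark_equations : seq A :=
  [seq polR.[m.1] | m <- finite_marks A mk & m.2.1 == z1]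
  ++ (if (atoo mk).1 == z1 then
        [:: polR`_((size (sqfree_prod z0 * sqfree_prod zoo)).-1
                   - (atoo mk).2)]
      else [::]).

End Ansatz.

Section Algorithm.
Variables (C : numClosedFieldType) (b : Delta -> seq nat) (mk : marking).

Let n := size (unknown_points b mk).

Definition equations : seq {mpoly C[n]} :=
  let X := fun i : 'I_n => 'X_i : {mpoly C[n]} in
  numerator_equations X ++ mark_equations X.

Definition solution (v : 'I_n -> C) : Prop :=
  forall e, e \in equations -> e.@[v] = 0.

(* The points in the fibers of 0 and oo do not collide. *)
Definition nondegenerate_coefs (v : 'I_n -> C) : Prop :=
  separable_poly (sqfree_prod v z0 * sqfree_prod v zoo).

Definition phi (v : 'I_n -> C) (K : C) : {fraction {poly C}} :=
  (K *: polP v)%:F / (polQ v)%:F.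

Definition phi_tilde (v : 'I_n -> C) : {fraction {poly C}} :=
  (polR v ^+ 2)%:F / (polQ v)%:F.

Definition output (f : {fraction {poly C}}) : Prop :=
  exists v K, [/\ solution v, nondegenerate_coefs v,
                  proportional (1 - phi v K) (phi_tilde v) & f = phi v K].

Definition has_point (f : {fraction {poly C}}) (x : option C) (p : point) :=
  feval f x = pt C p.1 /\ ramidx f x = p.2.

Definition respects_marking (f : {fraction {poly C}}) : Prop :=
  [/\ has_point f (Some 0) (at0 mk),
      forall p, at1 mk = Some p -> has_point f (Some 1) p
    & has_point f None (atoo mk)].

End Algorithm.

(* Main.v *)
Require Import Defs.
From HB Require Import structures.
From mathcomp Require Import all_boot all_order all_algebra.
From mathcomp Require Import generic_quotient separable mpoly.
From mathcomp Require Import zify ring.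

Set Implicit Arguments.
Unset Strict Implicit.
Unset Printing Implicit Defensive.

Import GRing.Theory Num.Theory.
Local Open Scope ring_scope.

(* Write P = S L and Q = T M with S, T the square-free parts. Then
   P'Q - PQ' = L M R, where R, the numerator of phi'/phi, is prime to S T, and
   (R^2)'Q - R^2 Q' = R N M, where N is the numerator of Phi. Hence N = k L says
   that R^2/Q and k P/Q have the same derivative, i.e. R^2 = k P + e Q; here
   k, e <> 0 because S T has degree at least 2. So Q - K P is proportional to
   R^2, where R has simple roots, and the degree of R, known from comparing
   degrees in the two Wronskian identities (Riemann-Hurwitz), leaves exactly the
   prescribed order at infinity. Conversely, for a Belyi function the form of
   the fiber of 1 is a square W^2 away from infinity; W divides R by the first
   identity, has the degree of R, and so R is proportional to W, which turns the
   second identity into N = k L. Fractional-linear changes of coordinates carry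
   the three fibers to the chosen order and the marked points to 0, 1, oo. *)

(** * Rational functions in lowest terms *)

Section Fractions.
Variable C : fieldType.
Implicit Types (f : {fraction {poly C}}) (p q : {poly C}) (x y : option C).

(** The point [x = oo] shapes the proof. Fibers are read as binary forms of degree [fdeg f], so that
    a drop in degree is a zero at infinity; but [P], [Q] and [R] see finite points only, and the
    degree of [R] needs a separate argument. Let [m] be the number of finite points above [z = 1]
    and [e] the order of infinity there (0 if it lies elsewhere), so that [2 m + e = d]. As there
    are [d + 2] points in all, [S T] has degree [d + 1 - m]. If infinity is not above 1, then [P]
    and [Q] have different degrees and the first identity gives [deg R = d - m = m]. If it is, the
    leading terms of the Wronskian cancel, and for a solution the two identities give only
    [m <= deg R < m + e]. For [e = 1] this suffices; for [e = 2] the equation at infinity in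
    [mark_equations] excludes [deg R = m + 1]. Moreover, the unknowns are coefficients while fibers
    are sets of points. One index set serves for both, through the roots of the factor of each
    kind. *)

Lemma mul_frac_denom f : f * (\d_(repr f))%:F = (\n_(repr f))%:F.
Proof.
rewrite -{1}[f]reprK; unlock FracField.tofrac.
rewrite -[LHS]FracField.pi_mul; apply/eqmodP => /=.
rewrite FracField.equivfE /FracField.mulf !numden_Ratio ?mulr1 ?oner_eq0 ?denom_ratioP //.
by rewrite mulrC.
Qed.

Lemma dvd_fracE f : let r := repr f in
  \n_r = fnum f * gcdp \n_r \d_r /\ \d_r = fden f * gcdp \n_r \d_r.
Proof. by split; rewrite divpK ?dvdp_gcdl ?dvdp_gcdr. Qed.

Lemma gcd_repr_neq0 f : gcdp \n_(repr f) \d_(repr f) != 0.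
Proof. by rewrite gcdp_eq0 negb_and (denom_ratioP (repr f)) orbT. Qed.

Lemma fden_neq0 f : fden f != 0.
Proof.
apply: contraTneq (denom_ratioP (repr f)) => d0.
by rewrite (proj2 (dvd_fracE f)) d0 mul0r eqxx.
Qed.

Lemma coprime_fnum_fden f : coprimep (fnum f) (fden f).
Proof. by rewrite coprimep_div_gcd // (denom_ratioP (repr f)) orbT. Qed.

Lemma fracE f : f = (fnum f)%:F / (fden f)%:F.
Proof.
have [En Ed] := dvd_fracE f; have := mul_frac_denom f.
rewrite {1}En {1}Ed !tofracM mulrA => /(mulIf _) E.
have {}E : f * (fden f)%:F = (fnum f)%:F.
  by apply: E; rewrite tofrac_eq0 gcd_repr_neq0.
by apply/(canRL (mulfK _)) => //; rewrite tofrac_eq0 fden_neq0.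
Qed.

Lemma eq_frac p q p' q' : q != 0 -> q' != 0 ->
  (p%:F / q%:F == p'%:F / q'%:F) = (p * q' == p' * q).
Proof.
by move=> q0 q'0; rewrite eqr_div ?tofrac_eq0 // -!tofracM tofrac_eq.
Qed.

(** Cross-multiplying the two reduced fractions and applying Gauss on both sides makes the
    denominators divide each other; the constant between them passes to the numerators. *)
Lemma fnum_fden_frac p q : coprimep p q -> q != 0 ->
  exists2 a : C, a != 0 &
    fnum (p%:F / q%:F) = a *: p /\ fden (p%:F / q%:F) = a *: q.
Proof.
move=> cpq q0; set f := _ / _.
have /eqP := fracE f; rewrite eq_frac ?fden_neq0 // => /eqP E.
have cf := coprime_fnum_fden f; have d0 := fden_neq0 f.
have /eqpP [[a b] /= /andP[a0 b0] Eq] : fden f %= q.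
  have cf' : coprimep (fden f) (fnum f) by rewrite coprimep_sym.
  have cqp : coprimep q p by rewrite coprimep_sym.
  rewrite /eqp -(Gauss_dvdpr _ cf') -(Gauss_dvdpr (fden f) cqp).
  by apply/andP; split; [rewrite -E | rewrite E]; rewrite dvdp_mull.
have Ed : fden f = (b / a) *: q.
  by rewrite mulrC -scalerA -Eq scalerA mulVf // scale1r.
exists (b / a); first by rewrite mulf_neq0 ?invr_eq0.
split=> //; apply: (mulIf q0); by rewrite -E Ed -scalerAl -scalerAr.
Qed.

Lemma fdeg_frac p q : coprimep p q -> q != 0 ->
  fdeg (p%:F / q%:F) = (maxn (size p) (size q)).-1.
Proof.
move=> cpq q0; have [a a0 [En Ed]] := fnum_fden_frac cpq q0.
by rewrite /fdeg En Ed !size_scale.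
Qed.

(** For a coprime fraction [p / q] these are the fiber forms up to one common constant,
    independently of the representative chosen by [repr]. *)
Definition pencil p q y : {poly C} := if y is Some t then p - t *: q else q.

Lemma fiber_poly_frac p q : coprimep p q -> q != 0 ->
  exists2 a : C, a != 0 &
    forall y, fiber_poly (p%:F / q%:F) y = a *: pencil p q y.
Proof.
move=> cpq q0; have [a a0 [En Ed]] := fnum_fden_frac cpq q0.
exists a => // -[t|] //=; rewrite En Ed // scalerBr !scalerA.
by rewrite [t * a]mulrC.
Qed.

Lemma fderiv_frac p q : q != 0 ->
  fderiv (p%:F / q%:F) = (p^`() * q - p * q^`())%:F / (q ^+ 2)%:F.
Proof.
move=> q0; set f := _ / _; rewrite /fderiv.
have /eqP := fracE f; rewrite eq_frac ?fden_neq0 // => /eqP E.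
apply/eqP; rewrite eq_frac ?expf_neq0 ?fden_neq0 // eq_sym; apply/eqP.
have E' := congr1 deriv E; rewrite !derivM in E'.
set n := fnum f in E E' *; set d := fden f in E E' *.
have d0 : d != 0 by exact: fden_neq0.
(* Both sides are arranged so that they differ only by the two sides of [n q = p d] and of its
   derivative. *)
have -> : (p^`() * q - p * q^`()) * d ^+ 2 =
   (p^`() * d + p * d^`()) * q * d - p * d * (q^`() * d + q * d^`()) by ring.
have -> : (n^`() * d - n * d^`()) * q ^+ 2 =
   (n^`() * q + n * q^`()) * q * d - n * q * (q^`() * d + q * d^`()) by ring.
by rewrite E' E.
Qed.

(* The multiplicity at [x] of [p], read as a binary form of degree [d]. *)
Definition ord_at (d : nat) p x : nat :=
  if x is Some t then mup t p else (d - (size p).-1)%N.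

Lemma ramidxE f x :
  ramidx f x = ord_at (fdeg f) (fiber_poly f (feval f x)) x.
Proof. by []. Qed.

Lemma ord_atZ d a p x : a != 0 -> ord_at d (a *: p) x = ord_at d p x.
Proof.
move=> a0; case: x => [t|] /=; last by rewrite size_scale.
by rewrite -mul_polyC mupMr // rootC.
Qed.

Lemma root_mup p t : p != 0 -> root p t = (0 < mup t p)%N.
Proof. by move=> p0; rewrite -dvdp_XsubCl XsubC_dvd. Qed.

Lemma size_fiber_poly f y : (size (fiber_poly f y) <= (fdeg f).+1)%N.
Proof.
have sz: (size (fnum f) <= (fdeg f).+1)%N /\ (size (fden f) <= (fdeg f).+1)%N.
  rewrite /fdeg; lia.
case: sz => sn sd; case: y => [t|] //=.
rewrite (leq_trans (size_polyD _ _)) // geq_max sn size_polyN.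
exact: leq_trans (size_scale_leq _ _) sd.
Qed.

(** A vanishing member would make the numerator a multiple of the denominator; being coprime, both
    would be constant. *)
Lemma fiber_poly_neq0 f y : (0 < fdeg f)%N -> fiber_poly f y != 0.
Proof.
move=> df; case: y => [t|] /=; last exact: fden_neq0.
apply/negP => /eqP/subr0_eq E; move: df (coprime_fnum_fden f).
rewrite /fdeg E => df; have /coprimep_dvdr h : fden f %| t *: fden f.
  by rewrite -mul_polyC dvdp_mull.
move=> /h; rewrite coprimepp => /eqP s1; move: df (size_scale_leq t (fden f)).
by rewrite s1 => df /maxn_idPr m1; rewrite m1 in df.
Qed.

(** Numerator and denominator, as forms of degree [fdeg f], have no common zero: at a finite point
    by coprimality, at infinity because one of them attains the degree. *)
Lemma feval_eq f x y : (0 < fdeg f)%N ->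
  (feval f x == y) = (0 < ord_at (fdeg f) (fiber_poly f y) x)%N.
Proof.
move=> df; have g0 := fiber_poly_neq0 y df; have sg := size_fiber_poly f y.
set n := fnum f in sg *; set e := fden f in sg *.
pose ab := if x is Some t then (n.[t], e.[t]) else (n`_(fdeg f), e`_(fdeg f)).
have ab0 : (ab.1 != 0) || (ab.2 != 0).
  rewrite /ab; case: (x) => [t|] /=.
    rewrite orbC -implybE; apply/implyP => /eqP et.
    have := coprime_fnum_fden f; rewrite coprimep_sym => /coprimep_root.
    by apply; apply/rootP.
  move: df; rewrite /fdeg -/n -/e /maxn.
  case: (ltnP (size n) (size e)) => _ df.
    by rewrite -lead_coefE lead_coef_eq0 fden_neq0 orbT.
  by rewrite -lead_coefE lead_coef_eq0 -size_poly_gt0; apply/orP; left; lia.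
have -> : (0 < ord_at (fdeg f) (fiber_poly f y) x)%N =
   (if y is Some s then ab.1 - s * ab.2 == 0 else ab.2 == 0).
  rewrite /ab; case: (x) => [t|] /=.
    by rewrite -root_mup // /root; case: (y) => //= s; rewrite !hornerE.
  have -> : (0 < fdeg f - (size (fiber_poly f y)).-1)%N =
            ((fiber_poly f y)`_(fdeg f) == 0).
    have sub_pred s : (0 < fdeg f - s.-1)%N = (s <= fdeg f)%N by lia.
    rewrite sub_pred; apply/idP/eqP => [|h]; first exact: nth_default.
    move: sg; rewrite leq_eqVlt => /orP[/eqP s|//].
    by move: g0; rewrite -lead_coef_eq0 lead_coefE s /= h eqxx.
  by case: (y) => //= s; rewrite coefB coefZ.
have -> : feval f x = if ab.2 == 0 then None else Some (ab.1 / ab.2).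
  by rewrite /ab; case: (x).
move: ab ab0 {sg g0} => [u w] /= uw; case: (altP (w =P 0)) uw => [->|w0] uw.
  by case: y => [s|] //=; rewrite mulr0 subr0; rewrite orbF in uw; rewrite (negPf uw).
case: y => [s|] //=.
by rewrite subr_eq0 -(can2_eq (divfK w0) (mulfK w0)).
Qed.
End Fractions.

(** * Fibers as binary forms *)

Section Forms.
Variable C : numClosedFieldType.
Implicit Types (f : {fraction {poly C}}) (p q : {poly C}) (x y : option C).

(* Points of the line as linear factors: a form of degree [d] with zeros [l]
   dehomogenizes to [\prod_(x <- l) lin x], so that infinity gives 1. *)
Definition lin x : {poly C} := if x is Some t then 'X - t%:P else 1.

Definition form (E : seq (option C * nat)) : {poly C} :=
  \prod_(e <- E) lin e.1 ^+ e.2.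

Lemma lin_neq0 x : lin x != 0.
Proof. by case: x => [t|] /=; rewrite ?polyXsubC_eq0 ?oner_eq0. Qed.

Lemma form_neq0 E : form E != 0.
Proof. by rewrite prodf_seq_neq0; apply/allP => e _; rewrite expf_neq0 ?lin_neq0. Qed.

Lemma size_form E :
  size (form E) = (\sum_(e <- E | e.1 != None) e.2).+1.
Proof.
rewrite /form; elim: E => [|[[t|] k] E IH]; first by rewrite !big_nil size_poly1.
  rewrite !big_cons /= size_mul ?form_neq0 ?expf_neq0 ?polyXsubC_eq0 //.
  by rewrite IH size_exp_XsubC addSn addnS.
by rewrite !big_cons /= expr1n mul1r.
Qed.

Lemma ord_at_form E a x : a != 0 ->
  ord_at (sumn (unzip2 E)) (a *: form E) x = (\sum_(e <- E | e.1 == x) e.2)%N.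
Proof.
move=> a0; rewrite ord_atZ //; case: x => [t|] /=.
  rewrite /form; elim: E => [|[x k] E IH].
    by rewrite !big_nil mupNroot // root1.
  rewrite !big_cons /= mupM ?form_neq0 ?expf_neq0 ?lin_neq0 // IH.
  case: x => [s|] /=; first by rewrite mup_XsubCX; case: (s =P t) => [->|/eqP st];
    rewrite ?eqxx // (inj_eq Some_inj) (negPf st).
  by rewrite expr1n mupNroot // root1.
rewrite size_form /= sumnE big_map (bigID (fun e => e.1 == None)) /=.
by rewrite addnK.
Qed.

(** Over an algebraically closed field a form splits; the roots missing to reach the formal degree
    [d] are copies of infinity. *)
Lemma poly_form d p : p != 0 -> (size p <= d.+1)%N ->
  exists2 l : seq (option C), size l = d &
    p = lead_coef p *: form [seq (x, 1%N) | x <- l].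
Proof.
move=> p0 sp; have [r Ep] := closed_field_poly_normal p.
have sr : size p = (size r).+1.
  by rewrite Ep size_scale ?lead_coef_eq0 // size_prod_XsubC.
exists (map Some r ++ nseq (d - size r) None).
  by rewrite size_cat size_map size_nseq subnKC //; lia.
rewrite [LHS]Ep /form map_cat big_cat -map_comp !big_map /=.
rewrite [X in _ * X]big1_seq ?mulr1 //=.
by move=> x /nseqP[-> _]; rewrite expr1n.
Qed.

Lemma sum_unit_form (l : seq (option C)) x :
  (\sum_(e <- [seq (y, 1) | y <- l] | e.1 == x) e.2)%N = count_mem x l.
Proof. by rewrite big_map /= sum1_count. Qed.

Lemma ord_at_unit_form (l : seq (option C)) a x : a != 0 ->
  ord_at (size l) (a *: form [seq (y, 1%N) | y <- l]) x = count_mem x l.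
Proof.
move=> a0; rewrite -sum_unit_form -(ord_at_form _ _ a0); congr ord_at.
by rewrite /unzip2 -map_comp sumnE big_map sum1_size.
Qed.

(** Positive exponents put every listed point in the fiber, and a total equal to the degree accounts
    for infinity, so that no point is missed. *)
Lemma fiber_ordersI f y E a : (0 < fdeg f)%N -> a != 0 ->
    fiber_poly f y = a *: form E -> uniq (unzip1 E) -> 0%N \notin unzip2 E ->
    sumn (unzip2 E) = fdeg f ->
  fiber_orders f y (unzip2 E) /\
  forall e, e \in E -> feval f e.1 = y /\ ramidx f e.1 = e.2.
Proof.
move=> df a0 Ef uE E0 sE.
have ordE x : ord_at (fdeg f) (fiber_poly f y) x =
    (\sum_(e <- E | e.1 == x) e.2)%N by rewrite Ef -sE ord_at_form.
have memE e : e \in E -> ord_at (fdeg f) (fiber_poly f y) e.1 = e.2.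
  move=> eE; rewrite ordE -big_filter.
  have -> : [seq i <- E | i.1 == e.1] = [:: e]; last by rewrite big_seq1.
  elim: E uE eE {Ef E0 sE ordE} => //= u E IH /andP[uE uqE].
  rewrite inE => /orP[/eqP Eu|eE].
    rewrite Eu eqxx; congr cons; apply/eqP; rewrite -[_ == _]negbK -has_filter.
    by apply: contra uE => /hasP[w wE /eqP <-]; apply: map_f.
  by rewrite IH //; case: eqP => // Eu; move: uE; rewrite Eu map_f.
have evE e : e \in E -> feval f e.1 = y.
  move=> eE; apply/eqP; rewrite feval_eq // memE // lt0n.
  by apply: contraNneq E0 => <-; apply: map_f.
have rE e : e \in E -> ramidx f e.1 = e.2.
  by move=> eE; rewrite -[RHS]memE // /ramidx evE.
split=> [|e eE]; last by split; [exact: evE | exact: rE].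
exists (unzip1 E); split=> // [x|].
  apply/mapP/idP => [[e eE ->]|]; first by rewrite evE.
  rewrite feval_eq // ordE -big_filter; case fE: [seq _ <- E | _] => [|e s].
    by rewrite big_nil.
  have : e \in [seq e <- E | e.1 == x] by rewrite fE mem_head.
  by rewrite mem_filter => /andP[/eqP <- eE] _; exists e.
rewrite /unzip1 /unzip2 -map_comp.
by have -> : map (ramidx f \o fst) E = map snd E by apply/eq_in_map => e /rE.
Qed.

(** The fiber form splits into points with repetition, and each point is repeated as often as its
    ramification index. *)
Lemma fiber_ordersE f y l : (0 < fdeg f)%N -> fiber_orders f y l ->
  exists E, [/\ uniq (unzip1 E), perm_eq (unzip2 E) l,
    fiber_poly f y = lead_coef (fiber_poly f y) *: form E,
    forall x, (x \in unzip1 E) = (feval f x == y)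
  & forall e, e \in E -> feval f e.1 = y /\ ramidx f e.1 = e.2].
Proof.
move=> df [xs [uxs mxs pxs]]; have g0 := fiber_poly_neq0 y df.
have [s sz Es] := poly_form g0 (size_fiber_poly f y).
have ordE x : ord_at (fdeg f) (fiber_poly f y) x = count_mem x s.
  by rewrite Es -sz ord_at_unit_form // lead_coef_eq0.
exists [seq (x, ramidx f x) | x <- xs]; split.
- by rewrite /unzip1 -map_comp map_id.
- by rewrite /unzip2 -map_comp.
- rewrite {1}Es; congr (_ *: _); rewrite /form !big_map /=.
  have -> : \prod_(x <- s) lin x ^+ 1 = \prod_(x <- s) lin x by [].
  rewrite -prodr_undup_exp_count (perm_big xs) /=.
    apply: eq_big_seq => x; rewrite mxs => /eqP fx.
    by rewrite -ordE -fx.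
  apply: uniq_perm => // [|x]; first exact: undup_uniq.
  by rewrite mxs mem_undup feval_eq // ordE -has_count has_pred1.
- by move=> x; rewrite /unzip1 -map_comp map_id mxs.
- by move=> e /mapP[x]; rewrite mxs => /eqP fx ->.
Qed.

End Forms.

(** * Fractional-linear transformations *)

Section Moebius.
Variable C : numClosedFieldType.
Implicit Types (f : {fraction {poly C}}) (p q : {poly C}) (x y : option C).

Definition mact (a b c d : C) x : option C :=
  if x is Some t then
    if c * t + d == 0 then None else Some ((a * t + b) / (c * t + d))
  else if c == 0 then None else Some (a / c).

Definition moebius_map (m : option C -> option C) : Prop :=
  exists a b c d, a * d - b * c != 0 /\ m =1 mact a b c d.

(** The adjugate matrix inverts the original up to the determinant, a scalar that does not act on
    the line. *)
Lemma mactK a b c d : a * d - b * c != 0 ->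
  cancel (mact a b c d) (mact d (- b) (- c) a).
Proof.
move=> D [t|] /=; last first.
  case: (altP (c =P 0)) => [c0|c0] /=; first by rewrite c0 oppr0 eqxx.
  have -> : - c * (a / c) + a = 0 by field.
  by rewrite eqxx.
case: (altP (c * t + d =P 0)) => [e0|e0] /=.
  have c0 : c != 0.
    apply: contraNneq D => c0; move: e0; rewrite c0 mul0r add0r => ->.
    by rewrite !mulr0 subrr.
  rewrite oppr_eq0 (negPf c0); congr Some.
  have -> : d = - (c * t) by apply/eqP; rewrite -addr_eq0 addrC e0.
  by field.
have -> : - c * ((a * t + b) / (c * t + d)) + a = (a * d - b * c) / (c * t + d).
  by field.
rewrite mulf_eq0 invr_eq0 (negPf D) (negPf e0) /=; congr Some.
by field; rewrite ?D ?e0.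
Qed.

Lemma mactK' a b c d : a * d - b * c != 0 ->
  cancel (mact d (- b) (- c) a) (mact a b c d).
Proof.
move=> D x; have D' : d * a - (- b) * (- c) != 0 by rewrite mulrNN mulrC.
by have := mactK D' x; rewrite !opprK.
Qed.

(* The substitution of the two linear forms in a binary form of degree [n]. *)
Definition hsub (A B : {poly C}) n p : {poly C} :=
  \sum_(i < n.+1) p`_i *: (A ^+ i * B ^+ (n - i)).

Lemma hsubB A B n p q t :
  hsub A B n (p - t *: q) = hsub A B n p - t *: hsub A B n q.
Proof.
rewrite /hsub scaler_sumr -sumrB; apply: eq_bigr => i _.
by rewrite coefB coefZ scalerBl scalerA.
Qed.

Lemma hsubZ A B n a p : hsub A B n (a *: p) = a *: hsub A B n p.
Proof.
by rewrite /hsub scaler_sumr; apply: eq_bigr => i _; rewrite coefZ scalerA.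
Qed.

Lemma hsubSX A B n p : hsub A B n.+1 ('X * p) = A * hsub A B n p.
Proof.
rewrite /hsub big_ord_recl coefXM eqxx scale0r add0r mulr_sumr.
apply: eq_bigr => i _; rewrite coefXM lift0 /= subSS exprS -scalerAr.
by rewrite mulrA.
Qed.

(** A formal degree that is one too high is a zero at infinity, whose linear form becomes [B]. *)
Lemma hsubS A B n p : (size p <= n.+1)%N -> hsub A B n.+1 p = B * hsub A B n p.
Proof.
move=> sp; rewrite /hsub big_ord_recr /= nth_default // scale0r addr0 mulr_sumr.
apply: eq_bigr => i _; rewrite -scalerAr mulrCA subSn -?exprS // -ltnS.
exact: ltn_ord.
Qed.

Lemma size_unit_form (l : seq (option C)) :
  (size (form [seq (x, 1%N) | x <- l]) <= (size l).+1)%N.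
Proof.
rewrite size_form big_map /= sum1_count ltnS; exact: count_size.
Qed.

Definition hlin (A B : {poly C}) x : {poly C} :=
  if x is Some r then A - r *: B else B.

Lemma hsub_form A B (l : seq (option C)) :
  hsub A B (size l) (form [seq (x, 1%N) | x <- l]) = \prod_(x <- l) hlin A B x.
Proof.
elim: l => [|x l IH] /=.
  rewrite /form !big_nil /hsub big_ord1 coef1 eqxx scale1r expr0 mul1r subnn.
  by rewrite expr0.
rewrite big_cons -IH /form big_cons /= expr1.
case: x => [r|] /=; last by rewrite mul1r hsubS // size_unit_form.
rewrite mulrBl mul_polyC hsubB hsubSX hsubS ?size_unit_form //.
by rewrite mulrBl scalerAl.
Qed.

(** The zero of a substituted linear form is the preimage of the old zero. The constant [k] is the
    leading coefficient of the result, or its constant term when the zero has moved to infinity; the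
    determinant keeps it nonzero. *)
Lemma hlin_lin a b c d x : a * d - b * c != 0 ->
  exists2 k : C, k != 0 &
   hlin (a *: 'X + b%:P) (c *: 'X + d%:P) x = k *: lin (mact d (- b) (- c) a x).
Proof.
move=> D; case: x => [r|] /=; last first.
  rewrite oppr_eq0; case: (altP (c =P 0)) => [c0|c0] /=.
    exists d; last by rewrite c0 scale0r add0r alg_polyC.
    by apply: contraNneq D => ->; rewrite c0 !mulr0 subrr.
  exists c => //; rewrite scalerBr; congr (_ + _).
  by rewrite -mul_polyC -polyCM -polyCN; congr _%:P; field.
have -> : a *: 'X + b%:P - r *: (c *: 'X + d%:P) =
          (a - r * c) *: 'X + (b - r * d)%:P :> {poly C}.
  by rewrite -!mul_polyC !rmorphB /= !rmorphM /=; ring.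
have -> : - c * r + a = a - r * c by ring.
case: (altP (a - r * c =P 0)) => [e0|e0] /=.
  exists (b - r * d); last by rewrite e0 scale0r add0r alg_polyC.
  apply: contraNneq D => f0; apply/eqP.
  have -> : a * d - b * c = (a - r * c) * d - (b - r * d) * c by ring.
  by rewrite e0 f0 !mul0r subrr.
exists (a - r * c) => //; rewrite scalerBr; congr (_ + _).
rewrite -mul_polyC -polyCM -polyCN; congr _%:P; field.
by rewrite e0.
Qed.

Lemma ord_at_hsub a b c d n p x : a * d - b * c != 0 -> p != 0 ->
    (size p <= n.+1)%N ->
  let q := hsub (a *: 'X + b%:P) (c *: 'X + d%:P) n p in
  q != 0 /\ ord_at n q x = ord_at n p (mact a b c d x).
Proof.
move=> D p0 sp; have [l sl Ep] := poly_form p0 sp.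
have lp0 : lead_coef p != 0 by rewrite lead_coef_eq0.
have [k k0 Ek] : exists2 k : C, k != 0 &
  \prod_(x <- l) hlin (a *: 'X + b%:P) (c *: 'X + d%:P) x =
  k *: form [seq (y, 1%N) | y <- map (mact d (- b) (- c) a) l].
  elim: l {sl Ep} => [|y l [k k0 IH]] /=.
    by exists 1; rewrite ?oner_eq0 // /form !big_nil scale1r.
  have [k' k'0 Ek'] := hlin_lin y D.
  exists (k' * k); first by rewrite mulf_neq0.
  by rewrite big_cons IH Ek' /form !big_cons /= expr1 -scalerAl -scalerAr scalerA.
have Eq : hsub (a *: 'X + b%:P) (c *: 'X + d%:P) n p = (lead_coef p * k) *:
    form [seq (y, 1%N) | y <- map (mact d (- b) (- c) a) l].
  by rewrite {1}Ep hsubZ -sl hsub_form Ek scalerA.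
split; first by rewrite Eq scaler_eq0 mulf_eq0 (negPf lp0) (negPf k0) form_neq0.
rewrite Eq [in RHS]Ep -sl ord_at_unit_form // -{1}(size_map (mact d (- b) (- c) a) l).
rewrite ord_at_unit_form ?mulf_neq0 // count_map; apply: eq_count => y /=.
by rewrite (can2_eq (mactK' D) (mactK D)).
Qed.

(** The composite is built by substituting in the binary forms of numerator and denominator.
    Substitution commutes with taking members of the pencil, so the fiber forms of the composite are
    the substituted fiber forms of [f]. *)
Lemma moebius_precomp f m : (0 < fdeg f)%N -> moebius_map m ->
  exists g, fdeg g = fdeg f /\
    forall x, feval g x = feval f (m x) /\ ramidx g x = ramidx f (m x).
Proof.
move=> df [a [b [c [d [D mE]]]]].
pose h := hsub (a *: 'X + b%:P) (c *: 'X + d%:P) (fdeg f).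
have hE x y : h (fiber_poly f y) != 0 /\
    ord_at (fdeg f) (h (fiber_poly f y)) x =
    ord_at (fdeg f) (fiber_poly f y) (m x).
  have := ord_at_hsub x D (fiber_poly_neq0 y df) (size_fiber_poly f y).
  by rewrite mE.
have hn0 : h (fnum f) != 0.
  by have [] := hE None (Some 0); rewrite /= scale0r subr0.
have hd0 : h (fden f) != 0 by have [] := hE None None.
(* At the image under [m] of a common zero, [f] would take both values 0 and infinity. Applied to
   [x = oo], this also shows that the degree is kept. *)
have no_common x : (0 < ord_at (fdeg f) (h (fnum f)) x)%N ->
    (0 < ord_at (fdeg f) (h (fden f)) x)%N -> False.
  have [_ ->] := hE x None; have [_] := hE x (Some 0).
  by rewrite {1 2}/fiber_poly scale0r subr0 => ->;
    have := feval_eq (m x) (Some 0) df; rewrite /= scale0r subr0 => <-;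
    have := feval_eq (m x) None df => /= <- /eqP ->.
have cop : coprimep (h (fnum f)) (h (fden f)).
  apply: Pdiv.ClosedField.root_coprimep => t rn.
  apply/negP => rd; apply: (no_common (Some t)); rewrite /= -root_mup //.
have sh p : (size (h p) <= (fdeg f).+1)%N.
  apply: (leq_trans (size_sum _ _ _)); apply/bigmax_leqP => i _.
  apply: (leq_trans (size_scale_leq _ _)).
  have sl (u v : C) : (size (u *: 'X + v%:P)%R <= 2)%N.
    rewrite (leq_trans (size_polyD _ _)) // geq_max size_polyC.
    by rewrite (leq_trans (size_scale_leq _ _)) ?size_polyX //; case: eqP.
  have se (u v : C) k : (size ((u *: 'X + v%:P) ^+ k)%R <= k.+1)%N.
    rewrite (leq_trans (size_poly_exp_leq _ _)) // ltnS.
    by have := sl u v; case: (size _) => [|[|[|]]] //= _; rewrite ?mul0n ?mul1n.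
  rewrite (leq_trans (size_polyMleq _ _)) //.
  have arith s t (j n : nat) : (s <= j.+1)%N -> (t <= (n - j).+1)%N ->
      (j < n.+1)%N -> ((s + t).-1 <= n.+1)%N by lia.
  exact: arith (se a b i) (se c d (fdeg f - i)%N) (ltn_ord i).
exists ((h (fnum f))%:F / (h (fden f))%:F).
have dg : fdeg ((h (fnum f))%:F / (h (fden f))%:F) = fdeg f.
  rewrite fdeg_frac //; have := no_common None; rewrite /=.
  have := sh (fnum f); have := sh (fden f).
  have : (0 < size (h (fden f)))%N by rewrite size_poly_gt0.
  have : (0 < size (h (fnum f)))%N by rewrite size_poly_gt0.
  move: (size _) (size _) => u v *.
  case: (ltnP u (fdeg f).+1) => ?; last by lia.
  case: (ltnP v (fdeg f).+1) => ?; last by lia.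
  by exfalso; lia.
split=> // x; have [k k0 Ek] := fiber_poly_frac cop hd0.
have Eh y : pencil (h (fnum f)) (h (fden f)) y = h (fiber_poly f y).
  by case: y => //= t; rewrite /h hsubB.
have E : feval ((h (fnum f))%:F / (h (fden f))%:F) x = feval f (m x).
  apply/eqP; rewrite feval_eq ?dg // Ek Eh ord_atZ //.
  by rewrite (proj2 (hE _ _)) -feval_eq.
split=> //; rewrite !ramidxE E dg Ek Eh ord_atZ //; exact: proj2 (hE _ _).
Qed.

Lemma moebius_frac m : moebius_map m ->
  exists mu : {fraction {poly C}}, mobius mu /\ feval mu =1 m.
Proof.
have c1 : coprimep ('X : {poly C}) 1 by rewrite coprimep1.
have n1 : (1 : {poly C}) != 0 by rewrite oner_eq0.
have d1 : fdeg (('X : {poly C})%:F / 1%:F) = 1%N.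
  by rewrite fdeg_frac // size_polyX size_poly1.
move=> /(moebius_precomp (f := ('X)%:F / 1%:F)); rewrite d1 => /(_ isT) [g [dg eg]].
exists g; split=> // x; rewrite (proj1 (eg x)); apply/eqP.
rewrite feval_eq ?d1 //; have [k k0 Ek] := fiber_poly_frac c1 n1.
rewrite Ek ord_atZ //; case: (m x) => [t|] /=; last by rewrite size_poly1.
have -> : 'X - t *: 1 = lin (Some t) by rewrite /= alg_polyC.
by rewrite -root_mup ?lin_neq0 //= root_XsubC.
Qed.

(** A matrix applied to the pair of numerator and denominator only relabels the members of their
    pencil, so the fiber forms are the same up to constants. *)
Lemma moebius_postcomp f m : (0 < fdeg f)%N -> moebius_map m ->
  exists g, fdeg g = fdeg f /\ forall x, feval g x = m (feval f x) /\ ramidx g x = ramidx f x.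
Proof.
move=> df [a [b [c [d [D mE]]]]]; set n := fnum f; set e := fden f.
have [n' n'E] : {n' | n' = a *: n + b *: e} by exists (a *: n + b *: e).
have [e' e'E] : {e' | e' = c *: n + d *: e} by exists (c *: n + d *: e).
have En : n = (a * d - b * c)^-1 *: (d *: n' - b *: e').
  have -> : d *: n' - b *: e' = (a * d - b * c) *: n.
    rewrite n'E e'E !scalerDr !scalerA opprD addrACA -!scalerBl [d * b]mulrC.
    by rewrite subrr scale0r addr0 [d * a]mulrC.
  by rewrite scalerA mulVf // scale1r.
have Ee : e = (a * d - b * c)^-1 *: (a *: e' - c *: n').
  have -> : a *: e' - c *: n' = (a * d - b * c) *: e.
    rewrite n'E e'E !scalerDr !scalerA opprD addrACA -!scalerBl [c * a]mulrC.
    by rewrite subrr scale0r add0r [c * b]mulrC.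
  by rewrite scalerA mulVf // scale1r.
have cop : coprimep n' e'.
  apply: Pdiv.ClosedField.root_coprimep => t /rootP n0; apply/negP => /eqP e0.
  have rn : root n t by apply/rootP; rewrite En !hornerE n0 e0 !mulr0 subrr mulr0.
  have := coprimep_root (coprime_fnum_fden f) rn.
  by rewrite -/e Ee !hornerE n0 e0 !mulr0 subrr mulr0 eqxx.
have size_comb (u v : C) (r s : {poly C}) :
    (size (u *: r + v *: s)%R <= maxn (size r) (size s))%N.
  rewrite (leq_trans (size_polyD _ _)) // geq_max !leq_max.
  by rewrite !size_scale_leq orbT.
have sn' := size_comb a b n e; have se' := size_comb c d n e.
rewrite -n'E in sn'; rewrite -e'E in se'.
have [sn se] : (size n <= maxn (size n') (size e'))%N /\
               (size e <= maxn (size n') (size e'))%N.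
  split; first rewrite En; last rewrite Ee maxnC;
    by rewrite (leq_trans (size_scale_leq _ _)) // -scaleNr size_comb.
have e'0 : e' != 0.
  apply/negP => /eqP e0; move: cop; rewrite e0 coprimep0 -size_poly_eq1 => /eqP s1.
  move: sn se df; rewrite /fdeg -/n -/e e0 s1 size_poly0 => sn se.
  by rewrite ltnNge -subn1 leq_subLR addn0 geq_max sn se.
(* Each pair of polynomials consists of linear combinations of the other, so the maximal sizes
   agree. *)
have arith s t s' t' : (s <= maxn s' t')%N -> (t <= maxn s' t')%N ->
   (s' <= maxn s t)%N -> (t' <= maxn s t)%N -> (maxn s' t').-1 = (maxn s t).-1.
  by lia.
have dg : fdeg (n'%:F / e'%:F) = fdeg f by rewrite fdeg_frac //; exact: arith.
exists (n'%:F / e'%:F); split=> // x.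
have [k k0 Ek] := fiber_poly_frac cop e'0.
have [k' k'0 Ek'] : exists2 k' : C, k' != 0 &
    pencil n' e' (m (feval f x)) = k' *: fiber_poly f (feval f x).
  rewrite mE; case: (feval f x) => [t|] /=; rewrite -/n -/e; last first.
    case: (altP (c =P 0)) => [c0|c0] /=.
      exists d; last by rewrite e'E c0 scale0r add0r.
      by apply: contraNneq D => ->; rewrite c0 !mulr0 subrr.
    exists (- (a * d - b * c) / c); first by rewrite mulf_neq0 ?oppr_eq0 ?invr_eq0.
    rewrite n'E e'E scalerDr !scalerA divfK // opprD addrACA subrr add0r -scalerBl.
    by congr (_ *: _); field.
  case: (altP (c * t + d =P 0)) => [z0|z0] /=.
    exists c.
      apply: contraNneq D => c0; move: z0; rewrite c0 mul0r add0r => ->.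
      by rewrite !mulr0 subrr.
    rewrite e'E scalerBr scalerA; congr (_ + _); rewrite -scaleNr.
    by congr (_ *: _); apply/eqP; rewrite -addr_eq0 addrC z0.
  exists ((a * d - b * c) / (c * t + d)); first by rewrite mulf_neq0 ?invr_eq0.
  rewrite n'E e'E !scalerDr scalerN !scalerA opprD addrACA -!scalerBl -scaleNr.
  by congr (_ *: _ + _ *: _); field.
have E : feval (n'%:F / e'%:F) x = m (feval f x).
  apply/eqP; rewrite feval_eq ?dg // Ek Ek' scalerA ord_atZ ?mulf_neq0 //.
  by rewrite -feval_eq.
by split=> //; rewrite !ramidxE E dg Ek Ek' scalerA ord_atZ ?mulf_neq0.
Qed.

End Moebius.

(** * Transformations through three given points *)

Section ThreePoints.
Variable C : numClosedFieldType.
Implicit Types x y : option C.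

Definition homog_coord x : C * C := if x is Some t then (t, 1) else (1, 0).
Definition hdet x y : C := (homog_coord x).1 * (homog_coord y).2 - (homog_coord y).1 * (homog_coord x).2.

Lemma hdet_eq0 x y : (hdet x y == 0) = (x == y).
Proof.
rewrite /hdet; case: x => [t|]; case: y => [s|] //=.
- by rewrite !mulr1 subr_eq0.
- by rewrite mulr0 mul1r add0r oppr_eq0 oner_eq0.
- by rewrite mulr0 mul1r subr0 oner_eq0.
- by rewrite !mulr0 subrr !eqxx.
Qed.

Definition projpt (u w : C) : option C := if w == 0 then None else Some (u / w).

Lemma projpt_scale k u w x : k != 0 -> u = k * (homog_coord x).1 -> w = k * (homog_coord x).2 ->
  projpt u w = x.
Proof.
move=> k0; case: x => [t|] /= -> ->; rewrite /projpt; last first.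
  by rewrite mulr0 eqxx.
by rewrite mulr1 (negPf k0) mulrAC divff // mul1r.
Qed.

(* The columns of the matrix are multiples of the homogeneous coordinates of
   the images of infinity and 0, scaled so that their sum represents the image
   of 1 (Cramer's rule). *)
Lemma exists_moebius x0 x1 xoo : x0 != x1 -> x0 != xoo -> x1 != xoo ->
  exists m : option C -> option C,
    [/\ moebius_map m, m (Some 0) = x0, m (Some 1) = x1 & m None = xoo].
Proof.
rewrite -!hdet_eq0 => d01 d0o d1o.
pose s := hdet x0 x1; pose t := hdet x1 xoo.
pose a := s * (homog_coord xoo).1; pose b := t * (homog_coord x0).1.
pose c := s * (homog_coord xoo).2; pose d := t * (homog_coord x0).2.
exists (mact a b c d); split.
- exists a, b, c, d; split=> //.
  have -> : a * d - b * c = - (s * t * hdet x0 xoo).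
    by rewrite /a /b /c /d /hdet; ring.
  by rewrite oppr_eq0 !mulf_neq0.
- rewrite /mact !mulr0 !add0r -/(projpt _ _); exact: (projpt_scale (k := t)).
- rewrite /mact !mulr1 -/(projpt _ _).
  by apply: (projpt_scale (k := hdet x0 xoo)) => //;
    rewrite /a /b /c /d /s /t /hdet; ring.
- exact: (projpt_scale (k := s)).
Qed.

Lemma moebius_map_bij (m : option C -> option C) : moebius_map m -> bijective m.
Proof.
move=> [a [b [c [d [D mE]]]]]; apply: (eq_bij _ (fsym mE)).
by exists (mact d (- b) (- c) a); [exact: mactK | exact: mactK'].
Qed.

End ThreePoints.

(** * Wronskians and logarithmic derivatives *)

Section Wronskian.
Variable C : numClosedFieldType.
Implicit Types p q : {poly C}.

Definition wronsk p q := p^`() * q - p * q^`().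

Lemma wronskBl p p' q : wronsk (p - p') q = wronsk p q - wronsk p' q.
Proof. by rewrite /wronsk derivB; ring. Qed.

Lemma wronskZl a p q : wronsk (a *: p) q = a *: wronsk p q.
Proof. by rewrite /wronsk derivZ -!scalerAl scalerBr. Qed.

Lemma wronskpp p : wronsk p p = 0.
Proof. by rewrite /wronsk mulrC subrr. Qed.

Lemma size_euler p :
  (size ('X * p^`() - (size p).-1%:R *: p)%R <= (size p).-1)%N.
Proof.
apply/leq_sizeP => i; rewrite coefB coefXM coefZ coef_deriv.
case: i => [|i] /= le.
  have -> : (size p).-1 = 0%N by move: le; move: (size p) => [|[|]].
  by rewrite mul0r subrr.
move: le; rewrite leq_eqVlt => /orP[/eqP <-|lt].
  by rewrite mulr_natl subrr.
by rewrite nth_default ?mul0rn ?mulr0 ?subrr //; move: lt; case: (size p).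
Qed.

(* The Euler operator [x d/dx] multiplies leading terms by the degree. *)
Lemma mulX_wronsk p q : exists2 r : {poly C}, (size r <= (size p + size q).-2)%N &
  'X * wronsk p q = ((size p).-1%:R - (size q).-1%:R) *: (p * q) + r.
Proof.
set m := (size p).-1; set n := (size q).-1.
exists (('X * p^`() - m%:R *: p) * q - p * ('X * q^`() - n%:R *: q)).
  have [-> | p0] := eqVneq p 0.
    by rewrite !(deriv0, scaler0, mulr0, mul0r, subrr, size_poly0).
  have [-> | q0] := eqVneq q 0.
    by rewrite !(deriv0, scaler0, mulr0, mul0r, subrr, size_poly0).
  rewrite (leq_trans (size_polyD _ _)) // size_polyN geq_max.
  have := size_euler p; have := size_euler q; rewrite -/m -/n => sq sp.
  have p1 : (0 < size p)%N by rewrite size_poly_gt0.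
  have q1 : (0 < size q)%N by rewrite size_poly_gt0.
  have arith (x y u v : nat) : (0 < u)%N -> (0 < v)%N -> (x <= u.-1)%N ->
     (y <= v)%N -> ((x + y).-1 <= (u + v).-2)%N by lia.
  rewrite (leq_trans (size_polyMleq _ _)) /=; last exact: arith.
  by rewrite (leq_trans (size_polyMleq _ _)) // addnC [X in (_ <= X.-2)%N]addnC; exact: arith.
rewrite scalerBl scalerAl scalerAr /wronsk -!mul_polyC; ring.
Qed.

Lemma size_wronsk_leq p q : (size (wronsk p q) <= (size p + size q).-2)%N.
Proof.
have [-> | w0] := eqVneq (wronsk p q) 0; first by rewrite size_poly0.
have [r sr E] := mulX_wronsk p q; rewrite -ltnS.
rewrite -[(size _).+1](size_mulX w0) mulrC E.
rewrite (leq_trans (size_polyD _ _)) // geq_max.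
have p0 : p != 0 by apply: contraNneq w0 => ->; rewrite /wronsk !(deriv0, mulr0, mul0r, subrr).
have q0 : q != 0 by apply: contraNneq w0 => ->; rewrite /wronsk !(deriv0, mulr0, mul0r, subrr).
rewrite (leq_trans (size_scale_leq _ _)) ?size_mul //.
  by rewrite (leq_trans sr) // leqnSn.
by move: p0 q0; rewrite -!size_poly_gt0; move: (size p) (size q) => [|u] [|v] //; rewrite addnS.
Qed.

(** In characteristic zero the difference of the degrees, which multiplies the product of the
    leading terms, is nonzero, so nothing cancels. *)
Lemma size_wronsk_neq p q : p != 0 -> q != 0 -> size p != size q ->
  size (wronsk p q) = (size p + size q).-2.
Proof.
move=> p0 q0 npq; have [r sr E] := mulX_wronsk p q.
have p1 : (0 < size p)%N by rewrite size_poly_gt0.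
have q1 : (0 < size q)%N by rewrite size_poly_gt0.
have c0 : (size p).-1%:R - (size q).-1%:R != 0 :> C.
  rewrite subr_eq0 eqr_nat; apply: contra npq => /eqP h; apply/eqP.
  by rewrite -(prednK p1) -(prednK q1) h.
have sX : size ('X * wronsk p q)%R = (size p + size q).-1.
  rewrite E size_polyDl size_scale // size_mul //.
  by move: sr p1 q1; move: (size p) (size q) (size r) => [|u] [|v] w //; rewrite addnS.
have w0 : wronsk p q != 0.
  apply: contra_eq_neq sX => ->; rewrite mulr0 size_poly0.
  by move: p1 q1 npq; move: (size p) (size q) => [|[|u]] [|[|v]] //; rewrite ?addnS ?addSn.
by move: sX; rewrite mulrC size_mulX // => <-.
Qed.

(** The coefficient of [p q] in the Euler identity is the difference of the degrees, here 0, so only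
    the remainder is left. *)
Lemma size_wronsk_eq p q : size p = size q ->
  (size (wronsk p q) <= (size p + size q).-2.-1)%N.
Proof.
move=> spq; have [-> | w0] := eqVneq (wronsk p q) 0; first by rewrite size_poly0.
have [r sr E] := mulX_wronsk p q.
have : (size (wronsk p q)).+1 = size r.
  by rewrite -(size_mulX w0) mulrC E spq subrr scale0r add0r.
by move=> Er; rewrite -Er in sr; move: sr; case: (_.-2).
Qed.

(** Subtract the multiple of [q] that removes the coefficient of [p] at the degree of [q]. A nonzero
    remainder would differ in degree from [q], and then its Wronskian with [q] would not vanish. *)
Lemma wronsk_eq0 p q : q != 0 -> wronsk p q = 0 -> exists e, p = e *: q.
Proof.
move=> q0 w0; pose e := p`_(size q).-1 / lead_coef q; exists e.
apply/eqP; rewrite -subr_eq0; set r := p - _; apply/negPn/negP => r0.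
have lq : lead_coef q != 0 by rewrite lead_coef_eq0.
have srq : size r != size q.
  apply: contra r0 => /eqP srq; rewrite -lead_coef_eq0 lead_coefE srq.
  by rewrite coefB coefZ -lead_coefE divfK // subrr.
have := size_wronsk_neq r0 q0 srq.
rewrite wronskBl wronskZl w0 wronskpp scaler0 subrr size_poly0.
have arith (u v : nat) : (0 < u)%N -> (0 < v)%N -> u != v -> 0%N <> (u + v).-2.
  by lia.
move=> h; apply: (arith _ _ _ _ _ h); rewrite ?size_poly_gt0 //.
Qed.

Lemma mup_deriv p a : p != 0 -> root p a ->
  p^`() != 0 /\ mup a p^`() = (mup a p).-1.
Proof.
move=> p0 pa; have m0 : (0 < mup a p)%N by rewrite -root_mup.
have /dvdpP[q Eq] : ('X - a%:P) ^+ mup a p %| p by rewrite -mup_geq.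
have q0 : q != 0 by apply: contraNneq p0 => q0; rewrite Eq q0 mul0r.
have qa : ~~ root q a.
  apply/negP; rewrite root_factor_theorem => /dvdpP[r Er].
  have : ('X - a%:P) ^+ (mup a p).+1 %| p by rewrite [X in _ %| X]Eq Er -mulrA -exprS dvdp_mull.
  by rewrite -mup_geq // ltnn.
move: m0 Eq; case: (mup a p) => // m _ Eq.
have Ep' : p^`() = (q^`() * ('X - a%:P) + m.+1%:R *: q) * ('X - a%:P) ^+ m.
  rewrite Eq derivM deriv_exp derivXsubC -mul_polyC polyC_natr exprS /=; ring.
have nr : ~~ root (q^`() * ('X - a%:P) + m.+1%:R *: q) a.
  rewrite rootE !hornerE subrr mulr0 add0r mulf_eq0 pnatr_eq0 /=.
  exact: qa.
rewrite Ep' mupMr // mup_XsubCX eqxx; split=> //.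
rewrite mulf_neq0 ?expf_neq0 ?polyXsubC_eq0 //.
by apply: contraNneq nr => ->; rewrite root0.
Qed.

Lemma mup_separable p a : separable_poly p -> (mup a p <= 1)%N.
Proof.
move=> sp; have p0 := separable_poly_neq0 sp; have [pa|] := boolP (root p a); last first.
  by move/mupNroot->.
have [p'0 mp'] := mup_deriv p0 pa.
have : ~~ root p^`() a by move: sp; rewrite unlock => /coprimep_root /(_ pa).
by rewrite root_mup // mp'; case: (mup a p) => [|[]].
Qed.

End Wronskian.

Section LogDerivative.
Variable C : numClosedFieldType.

(* [P' / P = D / S] with [S] the square-free part of [P] and [P = S * L]. *)
Definition log_deriv (P S L D : {poly C}) : Prop :=
  [/\ P = S * L, P^`() = L * D, S \is monic & L \is monic].

Section OneFiber.
Variables P S L D : {poly C}.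
Hypothesis hP : log_deriv P S L D.

Lemma log_deriv_monic : P \is monic.
Proof. by case: hP => -> _ mS mL; rewrite monicMr. Qed.

Let P0 : P != 0 := monic_neq0 log_deriv_monic.
Let S0 : S != 0. Proof. by case: hP => _ _ /monic_neq0. Qed.
Let L0 : L != 0. Proof. by case: hP => _ _ _ /monic_neq0. Qed.

(** Differentiation lowers the multiplicity of [P = S L] by one and yields [L D]; the multiplicity
    of [L] cancels. *)
Lemma log_deriv_mup a : root P a -> (mup a S = (mup a D).+1)%N.
Proof.
move=> Pa; have [P'0 mP'] := mup_deriv P0 Pa; move: mP' P'0.
case: hP => E E' _ _; rewrite E' E mulf_eq0 negb_or => + /andP[_ D0].
rewrite !mupM //; have : (0 < mup a (S * L))%N by rewrite -root_mup -?E.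
by rewrite mupM //; lia.
Qed.

Lemma log_deriv_root a : root S a = root P a.
Proof.
apply/idP/idP => [Sa|Pa]; last by rewrite root_mup // log_deriv_mup.
by case: hP => -> _ _ _; rewrite rootM Sa.
Qed.

Lemma log_deriv_mup_simple a : separable_poly S -> root P a ->
  ~~ root D a /\ mup a S = 1%N.
Proof.
move=> sepS Pa; have := log_deriv_mup Pa.
have := mup_separable a sepS => le1 E.
have D0 : D != 0.
  apply: contraTneq (proj1 (mup_deriv P0 Pa)) => D0.
  by case: hP => _ -> _ _; rewrite D0 mulr0 eqxx.
by rewrite root_mup //; lia.
Qed.

Lemma log_deriv_mup_lower a : separable_poly S -> mup a L = (mup a P).-1.
Proof.
move=> sepS; have [Pa|Pa] := boolP (root P a); last first.
  rewrite !mupNroot //; apply: contra Pa => La.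
  by case: hP => -> _ _ _; rewrite rootM La orbT.
have [_ S1] := log_deriv_mup_simple sepS Pa.
by case: hP => -> _ _ _; rewrite mupM // S1.
Qed.

Lemma size_log_deriv : (1 < size P)%N -> (size S = (size D).+1)%N.
Proof.
move=> sP; have sP' : size P^`() = (size P).-1.
  have := size_wronsk_neq P0 (oner_neq0 _).
  rewrite /wronsk derivC mulr1 mulr0 subr0 size_poly1 addn1 => -> //.
  by case: (size P) sP => [|[]].
have D0 : D != 0.
  apply: contraTneq sP => D0; case: hP sP' => _ -> _ _.
  by rewrite D0 mulr0 size_poly0; case: (size P) => [|[]].
case: hP sP' => -> -> _ _; rewrite !size_mul //.
move: S0 L0 D0; rewrite -!size_poly_gt0; move: (size S) (size L) (size D).
by case=> // s [] // l d _ _ d0; rewrite ?addSn ?addnS /=; lia.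
Qed.

End OneFiber.

(** * The numerators of the logarithmic derivatives of P / Q and R^2 / Q *)

Section TwoFibers.
Variables (P S L D Q T M G : {poly C}).
Hypotheses (hP : log_deriv P S L D) (hQ : log_deriv Q T M G).
Hypothesis sepST : separable_poly (S * T).
Hypothesis sizeST : (2 < size (S * T)%R)%N.

Definition logR := D * T - S * G.
Definition logN := (logR^`() *+ 2) * T - logR * G.
Local Notation R := logR.
Local Notation N := logN.

Let P0 : P != 0 := monic_neq0 (log_deriv_monic hP).
Let Q0 : Q != 0 := monic_neq0 (log_deriv_monic hQ).
Let S0 : S != 0. Proof. by case: hP => _ _ /monic_neq0. Qed.
Let L0 : L != 0. Proof. by case: hP => _ _ _ /monic_neq0. Qed.
Let T0 : T != 0. Proof. by case: hQ => _ _ /monic_neq0. Qed.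
Let M0 : M != 0. Proof. by case: hQ => _ _ _ /monic_neq0. Qed.

Lemma separable_left : separable_poly S.
Proof. by move: sepST; rewrite separable_mul => /and3P[]. Qed.
Lemma separable_right : separable_poly T.
Proof. by move: sepST; rewrite separable_mul => /and3P[]. Qed.
Lemma coprimeST : coprimep S T.
Proof. by move: sepST; rewrite separable_mul => /and3P[]. Qed.

Lemma wronskPQ : wronsk P Q = L * M * R.
Proof.
by case: hP => EP EP' _ _; case: hQ => EQ EQ' _ _;
  rewrite /wronsk EP' EQ' EP EQ /logR; ring.
Qed.

Lemma wronskR2Q : wronsk (R ^+ 2) Q = R * N * M.
Proof.
case: hQ => EQ EQ' _ _; rewrite /wronsk expr2 derivM EQ' EQ /logN; ring.
Qed.

Lemma rootS_coprime a : root S a -> ~~ root T a.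
Proof. by move=> /(coprimep_root coprimeST). Qed.

Lemma coprimePQ : coprimep P Q.
Proof.
apply: Pdiv.ClosedField.root_coprimep => a; rewrite -(log_deriv_root hP) => Sa.
by have := rootS_coprime Sa; rewrite (log_deriv_root hQ).
Qed.

(** At a root of [S] the value of [R = D T - S G] is that of [D T], and neither factor vanishes
    there; the roots of [T] are treated symmetrically. *)
Lemma coprimeR : coprimep R (S * T).
Proof.
rewrite coprimep_sym; apply: Pdiv.ClosedField.root_coprimep => a.
rewrite rootM => /orP[Sa|Ta]; rewrite /logR hornerD hornerN !hornerM.
  rewrite (rootP Sa) mul0r subr0 mulf_neq0 //; last exact: rootS_coprime.
  by have [] := log_deriv_mup_simple hP separable_left (a := a); rewrite -?(log_deriv_root hP).
rewrite (rootP Ta) mulr0 sub0r oppr_eq0 mulf_neq0 //.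
  by apply: contraL Ta => Sa; exact: rootS_coprime.
by have [] := log_deriv_mup_simple hQ separable_right (a := a); rewrite -?(log_deriv_root hQ).
Qed.

Lemma R_neq0 : R != 0.
Proof.
apply: contraTneq coprimeR => ->; rewrite coprime0p -size_poly_eq1.
by case: (size _) sizeST => [|[]].
Qed.

Lemma rootR_NP a : root R a -> ~~ root P a.
Proof.
move=> Ra; have := coprimep_root coprimeR Ra.
by rewrite -rootE rootM negb_or (log_deriv_root hP) => /andP[].
Qed.

Lemma rootR_NQ a : root R a -> ~~ root Q a.
Proof.
move=> Ra; have := coprimep_root coprimeR Ra.
by rewrite -rootE rootM negb_or (log_deriv_root hQ) => /andP[].
Qed.

(** If [P] is constant, then [S = 1] and [D = 0], so [R = - G] has degree one less than [T = S T],
    hence at least 1. The case of [Q] is symmetric. *)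
Lemma size_neq1_R : size P = 1%N \/ size Q = 1%N -> size R != 1%N.
Proof.
have one (P1 S1 L1 D1 : {poly C}) : log_deriv P1 S1 L1 D1 -> size P1 = 1%N ->
    S1 = 1 /\ D1 = 0.
  case=> E1 E1' mS mL s1; have := s1; rewrite E1 => /eqP; rewrite size_mul_eq1.
  move=> /andP[/size_poly1P[c _ Sc] _]; split.
    by move: mS; rewrite Sc monicE lead_coefC => /eqP ->.
  move/eqP: s1 => /size_poly1P[k _ Pk]; move/eqP: E1'.
  by rewrite Pk derivC eq_sym mulf_eq0 (negPf (monic_neq0 mL)) => /eqP.
rewrite /logR; case=> s1.
  have [S1 D0] := one _ _ _ _ hP s1; move: sizeST; rewrite S1 D0 mul0r !mul1r sub0r.
  rewrite size_polyN => sT; have := size_log_deriv hQ; move: sT.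
  case: hQ => -> _ _ _; rewrite size_mul //; move: T0 M0; rewrite -!size_poly_gt0.
  by move: (size T) (size M) (size G) => t m e; lia.
have [T1 G0] := one _ _ _ _ hQ s1; move: sizeST; rewrite T1 G0 mulr0 !mulr1 subr0.
move=> sS; have := size_log_deriv hP; move: sS.
case: hP => -> _ _ _; rewrite size_mul //; move: S0 L0; rewrite -!size_poly_gt0.
by move: (size S) (size L) (size D) => t m e; lia.
Qed.

(** The roots of [R] avoid [P] and [Q], so in case of equality [X] would have no root, and [X] and
    [R] would both be constant. *)
Lemma not_square_fiber c X : c != 0 -> X = P \/ X = Q -> R ^+ 2 != c *: X.
Proof.
move=> c0 hX; apply/negP => /eqP EX.
have sX : size X = 1%N.
  apply/eqP; apply: contraT => /closed_rootP[a Xa].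
  have Ra : root R a.
    have : root (R ^+ 2) a by rewrite EX rootE hornerZ (rootP Xa) mulr0.
    by rewrite expr2 rootM orbb.
  case: hX => EX'; rewrite EX' in Xa; first by have := rootR_NP Ra; rewrite Xa.
  by have := rootR_NQ Ra; rewrite Xa.
have : size (R ^+ 2) = 1%N by rewrite EX size_scale.
rewrite expr2 => /eqP; rewrite size_mul_eq1 andbb; apply/negP.
by apply: size_neq1_R; case: hX => <-; [left|right].
Qed.

Lemma logR_numerator K : K != 0 ->
  fderiv ((K *: P)%:F / Q%:F) / ((K *: P)%:F / Q%:F) = R%:F / (S * T)%:F.
Proof.
move=> K0; rewrite fderiv_frac //.
have KP0 : K *: P != 0 by rewrite scaler_eq0 negb_or K0.
rewrite invf_div mulf_div -!tofracM; apply/eqP.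
rewrite eq_frac ?mulf_neq0 ?expf_neq0 //; apply/eqP.
have := wronskZl K P Q; rewrite {1}/wronsk => ->; rewrite wronskPQ.
case: hP => EP _ _ _; case: hQ => EQ _ _ _; rewrite EP EQ -!mul_polyC; ring.
Qed.

Lemma proportional_fiber1 K :
  proportional (1 - (K *: P)%:F / Q%:F) ((R ^+ 2)%:F / Q%:F) <->
  exists2 a : C, a != 0 & Q - K *: P = a *: R ^+ 2.
Proof.
have Q0' : Q%:F != 0 :> {fraction {poly C}} by rewrite tofrac_eq0.
have E : 1 - (K *: P)%:F / Q%:F = (Q - K *: P)%:F / Q%:F :> {fraction {poly C}}.
  by rewrite tofracB mulrBl divff.
rewrite /proportional E; split=> -[a a0 Ea]; exists a => //.
  move/eqP: Ea; rewrite mulrA -tofracM eq_frac // mul_polyC => /eqP.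
  by move/(mulIf Q0).
by rewrite Ea -mul_polyC tofracM mulrA.
Qed.

(** * Consequences of N = k L *)

Section Solution.
Variable k : C.
Hypothesis hN : N = k *: L.

Lemma solution_pencil : exists e, R ^+ 2 = k *: P + e *: Q.
Proof.
have w0 : wronsk (R ^+ 2 - k *: P) Q = 0.
  rewrite wronskBl wronskZl wronskR2Q wronskPQ hN -!mul_polyC; ring.
by have [e Ee] := wronsk_eq0 Q0 w0; exists e; rewrite -Ee addrC subrK.
Qed.

Lemma solution_k_neq0 : k != 0.
Proof.
have [e E] := solution_pencil; apply/negP => /eqP k0.
have e0 : e != 0.
  apply: contraTneq (expf_neq0 2 R_neq0) => e0.
  by rewrite E k0 e0 !scale0r addr0 eqxx.
by have := not_square_fiber e0 (or_intror erefl); rewrite E k0 scale0r add0r eqxx.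
Qed.

Lemma solution_fiber1 : exists K a, a != 0 /\ Q - K *: P = a *: R ^+ 2.
Proof.
have [e E] := solution_pencil; have k0 := solution_k_neq0.
have e0 : e != 0.
  apply/negP => /eqP e0; have := not_square_fiber k0 (or_introl erefl).
  by rewrite E e0 scale0r addr0 eqxx.
exists (- k / e), e^-1; rewrite invr_eq0 e0; split=> //.
rewrite E scalerDr !scalerA mulVf // scale1r addrC mulNr scaleNr opprK.
by rewrite [k / e]mulrC.
Qed.

Lemma solution_fiber1_neq0 K a : a != 0 -> Q - K *: P = a *: R ^+ 2 -> K != 0.
Proof.
move=> a0 E; apply/negP => /eqP K0; move: E; rewrite K0 scale0r subr0 => E.
have ai0 : a^-1 != 0 by rewrite invr_eq0.
have := not_square_fiber ai0 (or_intror erefl).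
by rewrite E scalerA mulVf // scale1r eqxx.
Qed.

(** Scale the two equations to the same right-hand side. The Wronskian with [P] then compares [a]
    with [a'], and the one with [Q] compares [K] with [K']. *)
Lemma fiber1_uniq K a K' a' : Q - K *: P = a *: R ^+ 2 ->
  Q - K' *: P = a' *: R ^+ 2 -> a' != 0 -> K = K'.
Proof.
move=> E E' a'0; have R0 := R_neq0.
have W0 : wronsk P Q != 0 by rewrite wronskPQ !mulf_neq0.
have W0' : wronsk Q P != 0.
  by rewrite (_ : wronsk Q P = - wronsk P Q) ?oppr_eq0 // /wronsk; ring.
have F : a' *: (Q - K *: P) = a *: (Q - K' *: P).
  by rewrite E E' !scalerA [a * a']mulrC.
have := congr1 (fun X => wronsk X P) F; rewrite /= !wronskZl !wronskBl !wronskZl wronskpp.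
rewrite !scaler0 !subr0 => /eqP; rewrite -subr_eq0 -scalerBl scaler_eq0 (negPf W0').
rewrite orbF subr_eq0 => /eqP aa.
have := congr1 (fun X => wronsk X Q) F; rewrite /= !wronskZl !wronskBl !wronskZl wronskpp.
rewrite !sub0r !scalerN => /oppr_inj /eqP; rewrite !scalerA -subr_eq0 -scalerBl.
rewrite scaler_eq0 (negPf W0) orbF subr_eq0 -aa => /eqP; exact: mulfI.
Qed.

(** A double root of [R] would be a root of [N = k L], hence of [P], which [R] avoids. *)
Lemma solution_root_simple a : root R a -> ~~ root R^`() a.
Proof.
move=> Ra; apply/negP => R'a.
have : root N a by rewrite rootE /logN hornerD hornerN !hornerM hornerMn
  (rootP Ra) (rootP R'a) mul0rn !mul0r subrr.
rewrite hN rootZ ?solution_k_neq0 // => La; move: (rootR_NP Ra).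
by case: hP => -> _ _ _; rewrite rootM La orbT.
Qed.

(** A lower bound for the degree of [R], from the Wronskian of [R^2] and [Q], which is [k R L M]. *)
Lemma solution_size : (size L + 2 <= size R + size T)%N.
Proof.
have := size_wronsk_leq (R ^+ 2) Q; rewrite wronskR2Q hN -scalerAr -scalerAl.
rewrite size_scale ?solution_k_neq0 // expr2.
case: hQ => -> _ _ _; rewrite !size_mul ?mulf_neq0 ?R_neq0 //.
have := R_neq0; move: L0 T0 M0; rewrite -!size_poly_gt0.
by move: (size R) (size L) (size T) (size M) => r l t m; lia.
Qed.
End Solution.

Lemma size_logR_neq : size P != size Q -> size R = (size (S * T)%R).-1.
Proof.
move=> npq; have := size_wronsk_neq P0 Q0 npq; rewrite wronskPQ.
case: hP => -> _ _ _; case: hQ => -> _ _ _; rewrite !size_mul ?mulf_neq0 ?R_neq0 //.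
have := R_neq0; move: S0 L0 T0 M0; rewrite -!size_poly_gt0.
by move: (size R) (size S) (size L) (size T) (size M) => r n l t m; lia.
Qed.

(** Only an upper bound: the degree of the Wronskian drops by the ramification index of [P / Q] at
    infinity, which is not known here. *)
Lemma size_logR_eq : size P = size Q -> (size R <= (size (S * T)%R).-2)%N.
Proof.
move=> epq; have := size_wronsk_eq epq; rewrite wronskPQ.
case: hP => -> _ _ _; case: hQ => -> _ _ _; rewrite !size_mul ?mulf_neq0 ?R_neq0 //.
have := R_neq0; move: S0 L0 T0 M0; rewrite -!size_poly_gt0.
by move: (size R) (size S) (size L) (size T) (size M) => r n l t m; lia.
Qed.

(** * A member of the pencil that is proportional to a square *)

Section SquareFiber.
Variables (K a : C) (W : {poly C}).
Hypotheses (K0 : K != 0) (a0 : a != 0) (hW : Q - K *: P = a *: W ^+ 2).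

Let wronskW2Q : a *: wronsk (W ^+ 2) Q = - K *: (L * M * R).
Proof.
rewrite -wronskZl -hW wronskBl wronskZl wronskpp wronskPQ sub0r.
by rewrite scaleNr.
Qed.

Let W0 : W != 0.
Proof.
apply/negP => /eqP W0; have := wronskW2Q; rewrite W0 expr0n /wronsk deriv0 !mul0r.
rewrite subrr scaler0 => /esym/eqP; rewrite scaler_eq0 oppr_eq0 (negPf K0) /=.
by rewrite !mulf_eq0 (negPf R_neq0) (negPf L0) (negPf M0).
Qed.

(** An upper bound for the degree of [R], since the Wronskian of [a W^2] and [Q] is [- K L M R]. *)
Lemma square_fiber_size : (size R + size P + 2 <= (size W).*2 + size (S * T)%R)%N.
Proof.
have := size_wronsk_leq (W ^+ 2) Q; rewrite -(size_scale _ a0) wronskW2Q.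
rewrite size_scale ?oppr_eq0 // expr2.
case: hP => -> _ _ _; case: hQ => -> _ _ _; rewrite !size_mul ?mulf_neq0 ?R_neq0 //.
have := R_neq0; move: S0 L0 T0 M0 W0; rewrite -!size_poly_gt0.
by move: (size R) (size S) (size L) (size T) (size M) (size W) => r n l t m w; lia.
Qed.

(** A common root would be a root of [P] or [Q] and of [Q - K P], hence of both [P] and [Q], which
    are coprime. *)
Lemma coprime_square_fiber : coprimep W (L * M).
Proof.
apply: Pdiv.ClosedField.root_coprimep => x Wx; apply/negP => /eqP/rootP.
have /eqP : (Q - K *: P).[x] = 0 by rewrite hW hornerZ horner_exp (rootP Wx) expr0n mulr0.
rewrite hornerD hornerN hornerZ subr_eq0 => /eqP QP; rewrite rootM => LM.
have [Px Qx] : root P x /\ root Q x.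
  case/orP: LM => Lx.
    have Px : root P x by case: hP => -> _ _ _; rewrite rootM Lx orbT.
    by split=> //; apply/rootP; rewrite QP (rootP Px) mulr0.
  have Qx : root Q x by case: hQ => -> _ _ _; rewrite rootM Lx orbT.
  split=> //; apply/rootP/eqP; move/eqP: QP; rewrite (rootP Qx) eq_sym mulf_eq0.
  by rewrite (negPf K0).
by have := coprimep_root coprimePQ Px; rewrite (rootP Qx) eqxx.
Qed.

(** The square makes [W] a factor of the Wronskian of [W^2] and [Q], which is proportional to
    [L M R]. *)
Lemma dvd_square_fiber : W %| R.
Proof.
have h : W %| - K *: (L * M * R).
  rewrite -wronskW2Q dvdpZr //.
  have -> : wronsk (W ^+ 2) Q = W * (W^`() * Q *+ 2 - W * Q^`()).
    by rewrite /wronsk expr2 derivM; ring.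
  exact: dvdp_mulr.
by move: h; rewrite dvdpZr ?oppr_eq0 // Gauss_dvdpr // coprime_square_fiber.
Qed.

Lemma square_fiber_solution : (size R <= size W)%N ->
  (exists k, N = k *: L) /\ exists2 r, r != 0 & R = r *: W.
Proof.
move=> sRW; have /dvdpP [c Ec] := dvd_square_fiber.
have c0 : c != 0 by apply: contraNneq R_neq0 => c0; rewrite Ec c0 mul0r.
have /size_poly1P[r r0 cr] : size c == 1%N.
  move: sRW; rewrite Ec size_mul //; move: c0 W0; rewrite -!size_poly_gt0.
  by move: (size c) (size W) => u v; lia.
have ER : R = r *: W by rewrite Ec cr mul_polyC.
split; last by exists r.
have ER2 : R ^+ 2 = (r ^+ 2 / a) *: (Q - K *: P).
  by rewrite hW scalerA divfK // ER exprZn.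
(* As [R^2] is [r^2 / a] times [Q - K P], its Wronskian with [Q] is this constant times that of [P]
   and [Q]; cancelling [R M] leaves [N = k L]. *)
exists (- (r ^+ 2 / a * K)); apply: (mulfI R_neq0); apply: (mulIf M0).
rewrite -wronskR2Q ER2 wronskZl wronskBl wronskZl wronskpp sub0r wronskPQ.
rewrite -scaleNr scalerA mulrN -!mul_polyC; ring.
Qed.
End SquareFiber.

(** The roots of [L] are roots of [P], while those of [R] and [T] are not. *)
Lemma solution_coprime k : N = k *: L -> coprimep N (R * T).
Proof.
move=> hN; rewrite coprimep_sym; apply: Pdiv.ClosedField.root_coprimep => x.
have k0 := solution_k_neq0 hN; rewrite hN hornerZ mulf_eq0 (negPf k0) /=.
rewrite rootM => h; apply/negP => /eqP/rootP Lx.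
have Px : root P x by case: hP => -> _ _ _; rewrite rootM Lx orbT.
case/orP: h => [/rootR_NP|]; first by rewrite Px.
by apply/negP/rootS_coprime; rewrite (log_deriv_root hP).
Qed.

Lemma logN_numerator : fderiv ((R ^+ 2)%:F / Q%:F) / ((R ^+ 2)%:F / Q%:F) =
  N%:F / (R * T)%:F.
Proof.
rewrite fderiv_frac //; have R0 := R_neq0.
rewrite invf_div mulf_div -!tofracM; apply/eqP.
rewrite eq_frac ?mulf_neq0 ?expf_neq0 //; apply/eqP.
rewrite -/(wronsk _ _) wronskR2Q.
by case: hQ => EQ _ _ _; rewrite EQ; ring.
Qed.

End TwoFibers.
End LogDerivative.

(** * Undetermined coefficients and unknown points *)

Section FactorLists.
Variable A : comNzRingType.
Implicit Types fs gs : seq ({poly A} * nat).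

Lemma dlog_num_cat (us ws : seq ({poly A} * int)) :
  dlog_num (us ++ ws) = dlog_num us * (\prod_(h <- ws) h.1) +
                        (\prod_(h <- us) h.1) * dlog_num ws.
Proof.
elim: us => [|[g k] us IH] /=; first by rewrite big_nil mul0r mul1r add0r.
rewrite IH big_cat big_cons /=; ring.
Qed.

Definition pos_factors fs := [seq (g.1, g.2%:Z) | g <- fs].
Definition neg_factors fs := [seq (g.1, - g.2%:Z) | g <- fs].

Lemma prod_pos_factors fs : \prod_(h <- pos_factors fs) h.1 = \prod_(g <- fs) g.1.
Proof. by rewrite big_map. Qed.

Lemma prod_neg_factors fs : \prod_(h <- neg_factors fs) h.1 = \prod_(g <- fs) g.1.
Proof. by rewrite big_map. Qed.

Lemma dlog_num_neg fs : dlog_num (neg_factors fs) = - dlog_num (pos_factors fs).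
Proof.
elim: fs => [|[g k] fs IH] /=; first by rewrite oppr0.
by rewrite -/(neg_factors _) -/(pos_factors _) IH !big_map mulrNz; ring.
Qed.

Lemma prod_factors_lower fs : all (fun g => 0 < g.2)%N fs ->
  \prod_(g <- fs) g.1 ^+ g.2 =
  (\prod_(g <- fs) g.1) * (\prod_(g <- fs) g.1 ^+ g.2.-1).
Proof.
move=> /allP fs0; rewrite -big_split /=; apply: eq_big_seq => g /fs0.
by case: g => g [|k] //= _; rewrite exprS.
Qed.

Lemma deriv_factors fs : all (fun g => 0 < g.2)%N fs ->
  (\prod_(g <- fs) g.1 ^+ g.2)^`() =
  (\prod_(g <- fs) g.1 ^+ g.2.-1) * dlog_num (pos_factors fs).
Proof.
elim: fs => [|[g [//|k]] fs IH] /=; first by rewrite !big_nil derivC mul1r.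
move=> /[dup] /prod_factors_lower E /IH {}IH.
rewrite !big_cons /= derivM IH E big_map /= deriv_exp exprS.
rewrite -pmulrn -mulrnAl /=; move: (g^`() *+ k.+1) => c; ring.
Qed.

Lemma monic_prod_factors fs (h : nat -> nat) : all (fun g => g.1 \is monic) fs ->
  \prod_(g <- fs) g.1 ^+ h g.2 \is monic.
Proof.
elim: fs => [|g fs IH] /=; first by rewrite big_nil monic1.
by case/andP=> mg /IH m; rewrite big_cons monicMr ?monic_exp.
Qed.

End FactorLists.

Lemma log_deriv_factors (C : numClosedFieldType) (fs : seq ({poly C} * nat)) :
  all (fun g => 0 < g.2)%N fs -> all (fun g => g.1 \is monic) fs ->
  log_deriv (\prod_(g <- fs) g.1 ^+ g.2) (\prod_(g <- fs) g.1)
    (\prod_(g <- fs) g.1 ^+ g.2.-1) (dlog_num (pos_factors fs)).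
Proof.
move=> fs0 mfs; split; [exact: prod_factors_lower | exact: deriv_factors | |].
  exact: (monic_prod_factors (fun=> 1%N) mfs).
exact: (monic_prod_factors predn mfs).
Qed.

Lemma map_nth_index (T : eqType) (U : Type) (s : seq T) (s' : seq U) x0 :
  uniq s -> size s = size s' -> [seq nth x0 s' (index i s) | i <- s] = s'.
Proof.
move=> us ss; apply: (@eq_from_nth _ x0); first by rewrite size_map.
rewrite size_map; case: s us {ss} => // t s us i lt.
by rewrite (nth_map t) // index_uniq.
Qed.

Section Coefficients.
Variables (b : Delta -> seq nat) (mk : marking).

Local Notation unk := (unknown_points b mk).
Local Notation n := (size unk).
Local Notation kind := (tnth (in_tuple unk)).

Implicit Types p : point.

Definition indices p : seq 'I_n := [seq i <- enum 'I_n | kind i == p].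

Lemma uniq_indices p : uniq (indices p).
Proof. exact/filter_uniq/enum_uniq. Qed.

Lemma mem_indices p i : (i \in indices p) = (kind i == p).
Proof. by rewrite mem_filter mem_enum andbT. Qed.

Lemma size_indices p : size (indices p) = count_mem p unk.
Proof.
rewrite size_filter; have /= E := map_tnth_enum (in_tuple unk).
transitivity (count_mem p (map kind (enum 'I_n))).
  exact: esym (count_map kind (pred1 p) (enum 'I_n)).
by rewrite E.
Qed.

Lemma unknown_factor_size (A : comNzRingType) (v : 'I_n -> A) p :
  unknown_factor v p \is monic /\ size (unknown_factor v p) = (count_mem p unk).+1.
Proof.
have E : unknown_factor v p = rcons [seq v i | i <- indices p] 1 :> seq A.
  by rewrite /unknown_factor (@PolyK _ 0) ?last_rcons ?oner_eq0.
split; last by rewrite E size_rcons size_map size_indices.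
by rewrite monicE lead_coefE E size_rcons nth_rcons ltnn eqxx.
Qed.

(** The position of an unknown among those of its kind. It numbers both the coefficients and the
    roots of the factor of that kind. *)
Definition rank i := index i (indices (kind i)).

Lemma map_rank (T : Type) p (s : seq T) x0 : size s = count_mem p unk ->
  [seq nth x0 s (rank i) | i <- indices p] = s.
Proof.
move=> sz; rewrite -[RHS](map_nth_index x0 (uniq_indices p)) ?size_indices //.
by apply/eq_in_map => i; rewrite mem_indices /rank => /eqP ->.
Qed.

Variable C : numClosedFieldType.
Implicit Types v w : 'I_n -> C.

Lemma big_indices p (F : 'I_n -> {poly C}) :
  \prod_(i <- indices p) F i = \prod_(i | kind i == p) F i.
Proof. by rewrite big_filter big_enum_cond. Qed.

(** Each factor has as many roots as there are unknowns of its kind, so the roots can be distributed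
    over the same indices. *)
Lemma roots_of_coefs v : exists w,
  forall p, unknown_factor v p = \prod_(i | kind i == p) ('X - (w i)%:P).
Proof.
pose r p := sval (closed_field_poly_normal (unknown_factor v p)).
have rE p : unknown_factor v p = \prod_(x <- r p) ('X - x%:P).
  rewrite /r; case: closed_field_poly_normal => s /= {1}->.
  by have [/monicP -> _] := unknown_factor_size v p; rewrite scale1r.
have sr p : size (r p) = count_mem p unk.
  have [_] := unknown_factor_size v p.
  by rewrite rE size_prod_XsubC => -[].
exists (fun i => (r (kind i))`_(rank i)) => p.
rewrite -big_indices rE -{1}(map_rank 0 (sr p)) big_map.
by apply: eq_big_seq => i; rewrite mem_indices => /eqP ->.
Qed.

Lemma coefs_of_roots w : exists v,
  forall p, unknown_factor v p = \prod_(i | kind i == p) ('X - (w i)%:P).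
Proof.
pose g p : {poly C} := \prod_(i | kind i == p) ('X - (w i)%:P).
exists (fun i => (g (kind i))`_(rank i)) => p; rewrite -/(g p).
have sg : size (g p) = (count_mem p unk).+1.
  by rewrite /g -big_indices size_prod_XsubC size_indices.
have st : size (take (count_mem p unk) (g p)) = count_mem p unk.
  by rewrite size_take sg ltnSn.
rewrite /unknown_factor -/(indices p).
have -> : [seq (g (kind i))`_(rank i) | i <- indices p] =
          take (count_mem p unk) (g p).
  rewrite -[RHS](map_rank 0 st); apply/eq_in_map => i.
  move=> ip; have /eqP ki : kind i == p by rewrite -mem_indices.
  by rewrite ki nth_take // /rank ki -size_indices index_mem.
(* The 1 appended in [unknown_factor] is the leading coefficient of the monic [g p], which completes
   its list of coefficients. *)
have -> : 1 = (g p)`_(count_mem p unk).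
  have /monicP : g p \is monic by rewrite monic_prod_XsubC.
  by rewrite lead_coefE sg.
by rewrite -take_nth ?sg // take_oversize ?sg // polyseqK.
Qed.

End Coefficients.

(** * The points of the ansatz, with their fibers and orders *)

Section LabelledPoints.
Variables (C : numClosedFieldType) (b : Delta -> seq nat) (mk : marking).

Local Notation unk := (unknown_points b mk).
Local Notation n := (size unk).
Local Notation kind := (tnth (in_tuple unk)).
Implicit Types (v w : 'I_n -> C).

Definition labelled w : seq (C * point) :=
  [seq (w i, kind i) | i <- enum 'I_n] ++ finite_marks C mk.

Lemma labelled_points w :
  unzip2 (labelled w) = unk ++ unzip2 (finite_marks C mk).
Proof.
rewrite /unzip2 map_cat -map_comp; congr (_ ++ _).
by rewrite -[RHS](map_tnth_enum (in_tuple unk)).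
Qed.

Lemma big_labelled w (P : pred (C * point)) (F : C * point -> {poly C}) :
  \prod_(t <- labelled w | P t) F t =
  (\prod_(i | P (w i, kind i)) F (w i, kind i)) *
  \prod_(t <- finite_marks C mk | P t) F t.
Proof. by rewrite big_cat big_map big_enum_cond. Qed.

(** A factor collects all points of one kind; the double product over distinct kinds and points of a
    kind is regrouped into one product over points. A general [h] covers the full and the
    square-free product alike. *)
Lemma big_factors v w z (h : nat -> nat) :
  (forall p, unknown_factor v p = \prod_(i | kind i == p) ('X - (w i)%:P)) ->
  \prod_(g <- factors v z) g.1 ^+ h g.2 =
  \prod_(t <- labelled w | t.2.1 == z) ('X - t.1%:P) ^+ h t.2.2.
Proof.
move=> vw; rewrite big_labelled big_cat !big_map !big_filter /=; congr (_ * _).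
transitivity (\prod_(p <- undup unk | p.1 == z)
   \prod_(i | kind i == p) ('X - (w i)%:P) ^+ h p.2).
  by apply: eq_bigr => p _; rewrite vw prodrXl.
rewrite (exchange_big_dep (fun i => (kind i).1 == z)) /=; last first.
  by move=> p i pz /eqP ->.
apply: eq_bigr => i iz; rewrite -big_filter.
have -> : [seq p <- undup unk | (p.1 == z) && (kind i == p)] = [:: kind i].
  rewrite -(filter_pred1_uniq (undup_uniq unk) (x := kind i)); last first.
    by rewrite mem_undup mem_tnth.
  apply: eq_filter => p; rewrite [kind i == p]eq_sym andbC /=.
  by case: eqP => //= ->.
by rewrite big_seq1.
Qed.

Hypothesis mk_ok : forall p : point,
  (count_mem p (marked mk) <= count_mem p (pattern_points b))%N.

Lemma count_foldr_rem (T : eqType) (s m : seq T) p :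
  count_mem p (foldr (fun x s => rem x s) s m) =
  (count_mem p s - count_mem p m)%N.
Proof.
elim: m => [|x m IH] /=; first by rewrite subn0.
rewrite count_rem IH /=; case: (altP (x =P p)) => [->|xp]; last first.
  by rewrite andbF subn0 add0n.
rewrite andbT add1n subnS -subn1; case: (boolP (p \in _)) => //.
by move/count_memPn; rewrite IH => ->.
Qed.

Lemma perm_foldr_rem (T : eqType) (s m : seq T) :
  (forall p, count_mem p m <= count_mem p s)%N ->
  perm_eq (m ++ foldr (fun x s => rem x s) s m) s.
Proof.
move=> le; apply/allP => p _ /=.
by rewrite count_cat count_foldr_rem subnKC.
Qed.

Lemma pattern_pointsE z : [seq p.2 | p <- pattern_points b & p.1 == z] = b z.
Proof.
have fE z' (l : seq nat) : [seq p.2 | p <- [seq (z', k) | k <- l] & p.1 == z] =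
    if z' == z then l else [::].
  by elim: l => [|k l] /=; case: (z' == z) => //= ->.
rewrite /pattern_points /= !filter_cat !map_cat !fE.
by case: z {fE} => [[]|] /=; rewrite ?cats0.
Qed.

Lemma mem_pattern_points p : (p \in pattern_points b) = (p.2 \in b p.1).
Proof.
rewrite -[in RHS]pattern_pointsE; case: p => z k /=.
apply/idP/mapP => [pp|[p]]; first by exists (z, k); rewrite // mem_filter eqxx.
by rewrite mem_filter => /andP[/eqP <- +] ->; case: p.
Qed.

Lemma marked_pattern p : p \in marked mk -> p.2 \in b p.1.
Proof.
rewrite -mem_pattern_points -!has_pred1 !has_count => h.
exact: leq_trans h (mk_ok p).
Qed.

Lemma unknown_pattern p : p \in unk -> p.2 \in b p.1.
Proof.
rewrite mem_filter => /andP[_]; rewrite -mem_pattern_points.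
rewrite -!has_pred1 !has_count count_foldr_rem => h.
exact: leq_trans h (leq_subr _ _).
Qed.

(** The marked points removed from the pattern are put back; discarding the fiber of 1 from the
    unknowns changes nothing above another [z]. *)
Lemma perm_unknown z : z != z1 ->
  perm_eq [seq p.2 | p <- unk ++ unzip2 (finite_marks C mk) ++ [:: atoo mk]
                   & p.1 == z] (b z).
Proof.
move=> zz1; rewrite -[X in perm_eq _ X]pattern_pointsE; apply: perm_map.
rewrite -(permPr (perm_filter _ (perm_foldr_rem mk_ok))) !filter_cat perm_catC.
have -> : [seq p <- unk | p.1 == z] =
  [seq p <- foldr (fun x s => rem x s) (pattern_points b) (marked mk) | p.1 == z].
  rewrite -filter_predI; apply: eq_filter => p /=.
  by case: eqP => //= ->.
rewrite perm_cat2r -filter_cat perm_filter //= perm_cons perm_catC /=.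
by rewrite perm_cons /unzip2 -map_comp map_id.
Qed.

Definition proj_points w z : seq (option C * nat) :=
  [seq (Some t.1, t.2.2) | t <- labelled w & t.2.1 == z] ++
  [seq (None, p.2) | p <- [:: atoo mk] & p.1 == z].

Lemma perm_proj_points w z : z != z1 -> perm_eq (unzip2 (proj_points w z)) (b z).
Proof.
move=> zz1; apply: perm_trans (perm_unknown zz1).
rewrite catA filter_cat map_cat -(labelled_points w) /unzip2 map_cat -!map_comp.
apply: perm_cat; first by rewrite filter_map -map_comp.
exact: perm_refl.
Qed.

Section Factored.
Variables (v w : 'I_n -> C).
Hypothesis vw :
  forall p, unknown_factor v p = \prod_(i | kind i == p) ('X - (w i)%:P).

Lemma full_prodE z : full_prod v z = form (proj_points w z).
Proof.
rewrite /full_prod (big_factors z id vw) /form [RHS]big_cat big_map big_filter /=.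
rewrite [X in _ * X]big1_seq ?mulr1 // => e /mapP[p _ ->]; exact: expr1n.
Qed.

Lemma sqfree_prodE z : sqfree_prod v z =
  \prod_(x <- [seq t.1 | t <- labelled w & t.2.1 == z]) ('X - x%:P).
Proof.
rewrite /sqfree_prod; have := big_factors z (fun=> 1%N) vw => /= E.
by rewrite big_map big_filter.
Qed.

Lemma size_sqfree_prod z : z != z1 ->
  (size (sqfree_prod v z) + ((atoo mk).1 == z) = (size (b z)).+1)%N.
Proof.
move=> zz1; rewrite sqfree_prodE size_prod_XsubC.
rewrite -(perm_size (perm_proj_points w zz1)) /unzip2 /proj_points !size_map size_cat.
by rewrite !size_map /=; case: eqP.
Qed.

Lemma size_full_prod z : z != z1 ->
  (size (full_prod v z) + (if (atoo mk).1 == z then (atoo mk).2 else 0) =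
   (sumn (b z)).+1)%N.
Proof.
move=> zz1; rewrite full_prodE size_form addSn; congr _.+1.
rewrite -(perm_sumn (perm_proj_points w zz1)) sumnE big_map.
rewrite [RHS](bigID (fun e => e.1 == None)) addnC /=; congr addn.
rewrite /proj_points big_cat !big_map /= big_pred0 // add0n.
by case: eqP; rewrite ?big_nil ?big_cons ?big_nil ?addn0.
Qed.

Lemma factors_ok z : 0%N \notin b z ->
  all (fun g => 0 < g.2)%N (factors v z) /\
  all (fun g => g.1 \is monic) (factors v z).
Proof.
move=> b0; have pos k : k \in b z -> (0 < k)%N.
  by rewrite lt0n; apply: contraTneq => ->.
rewrite /factors !all_cat; split; apply/andP; split; apply/allP => g /mapP[x].
- rewrite mem_filter mem_undup => /andP[/eqP xz /unknown_pattern] + -> /=.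
  by rewrite xz => /pos.
- rewrite mem_filter => /andP[/eqP xz xm] -> /=; apply: pos; rewrite -xz.
  apply: marked_pattern; rewrite inE; move: xm; rewrite in_cons /= => /orP[/eqP -> | ].
    by rewrite eqxx.
  by case/mapP => y ym ->; rewrite /= inE ym !orbT.
- by move=> _ ->; have [] := unknown_factor_size v x.
- by move=> _ ->; exact: monicXsubC.
Qed.

Lemma log_deriv_fiber z : 0%N \notin b z ->
  log_deriv (full_prod v z) (sqfree_prod v z)
    (\prod_(g <- factors v z) g.1 ^+ g.2.-1) (dlog_num (pos_factors (factors v z))).
Proof. by case/factors_ok; exact: log_deriv_factors. Qed.

End Factored.
End LabelledPoints.

Section NumeratorsAsLog.
Variables (A : comNzRingType) (b : Delta -> seq nat) (mk : marking).
Variable v : 'I_(size (unknown_points b mk)) -> A.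
Local Notation Dv z := (dlog_num (pos_factors (factors v z))).

Lemma polRE : polR v =
  Dv z0 * sqfree_prod v zoo - sqfree_prod v z0 * Dv zoo.
Proof.
rewrite /polR -/(pos_factors _) /inv_factors -/(neg_factors _) dlog_num_cat.
by rewrite prod_pos_factors prod_neg_factors dlog_num_neg mulrN.
Qed.

Lemma polNE : polN v = ((polR v)^`() *+ 2) * sqfree_prod v zoo - polR v * Dv zoo.
Proof.
rewrite /polN /= /inv_factors -/(neg_factors _) prod_neg_factors dlog_num_neg.
by rewrite mulrN.
Qed.

End NumeratorsAsLog.

(** * Specialization of the equations *)

Section Specialization.
Variables (A B : comNzRingType) (phi : {rmorphism A -> B}).
Variables (b : Delta -> seq nat) (mk : marking).
Local Notation n := (size (unknown_points b mk)).
Variables (u : 'I_n -> A) (v : 'I_n -> B).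
Hypothesis uv : phi \o u =1 v.
Local Notation "p ^phi" := (map_poly phi p) (at level 2).

Lemma map_dlog_num (fs : seq ({poly A} * int)) :
  (dlog_num fs)^phi = dlog_num [seq (g.1^phi, g.2) | g <- fs].
Proof.
elim: fs => [|[g k] fs IH] /=; first by rewrite rmorph0.
by rewrite rmorphD !rmorphM /= IH rmorphMz deriv_map rmorph_prod big_map.
Qed.

Lemma map_unknown_factor p : (unknown_factor u p)^phi = unknown_factor v p.
Proof.
rewrite /unknown_factor map_Poly_id0 ?rmorph0 // map_rcons rmorph1 -map_comp.
by rewrite (eq_map uv).
Qed.

Lemma map_finite_marks :
  [seq (phi m.1, m.2) | m <- finite_marks A mk] = finite_marks B mk.
Proof.
rewrite /= rmorph0 -map_comp; congr cons.
by apply: eq_map => p /=; rewrite rmorph1.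
Qed.

Lemma map_factors z : [seq (g.1^phi, g.2) | g <- factors u z] = factors v z.
Proof.
rewrite /factors map_cat -!map_comp; congr (_ ++ _).
  by apply: eq_map => p /=; rewrite map_unknown_factor.
rewrite -map_finite_marks filter_map -map_comp; apply: eq_map => m /=.
by rewrite map_polyXsubC.
Qed.

Lemma map_factors_prod z (h : nat -> nat) :
  (\prod_(g <- factors u z) g.1 ^+ h g.2)^phi =
  \prod_(g <- factors v z) g.1 ^+ h g.2.
Proof.
rewrite rmorph_prod -map_factors big_map; apply: eq_bigr => g _.
by rewrite rmorphXn.
Qed.

Lemma map_sqfree_prod z : (sqfree_prod u z)^phi = sqfree_prod v z.
Proof. exact: (map_factors_prod z (fun=> 1%N)). Qed.

Lemma map_lowerP : (lowerP u)^phi = lowerP v.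
Proof. exact: (map_factors_prod z0 predn). Qed.

Lemma map_pos_factors z :
  [seq (g.1^phi, g.2) | g <- pos_factors (factors u z)] = pos_factors (factors v z).
Proof. by rewrite -map_factors /pos_factors -!map_comp. Qed.

Lemma map_polR : (polR u)^phi = polR v.
Proof.
by rewrite !polRE rmorphB !rmorphM /= !map_dlog_num !map_pos_factors !map_sqfree_prod.
Qed.

Lemma map_polN : (polN u)^phi = polN v.
Proof.
rewrite !polNE rmorphB !rmorphM /= rmorphMn /= -deriv_map.
by rewrite map_polR map_dlog_num map_pos_factors map_sqfree_prod.
Qed.

Lemma monic_factors_prod (R : comNzRingType) (y : 'I_n -> R) z (h : nat -> nat) :
  \prod_(g <- factors y z) g.1 ^+ h g.2 \is monic.
Proof.
apply: monic_prod_factors; rewrite all_cat; apply/andP; split; apply/allP => g /mapP[x _ ->].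
  by have [] := unknown_factor_size y x.
exact: monicXsubC.
Qed.

(** The equations mention the degrees of [lowerP] and of the square-free products over the ring of
    undetermined coefficients. These polynomials are monic, so their degrees survive
    specialization. *)
Lemma size_map_monic (p : {poly A}) : p \is monic -> size p^phi = size p.
Proof. by move=> /monicP p1; rewrite size_map_poly_id0 // p1 rmorph1 oner_neq0. Qed.

Lemma map_mark_equations : [seq phi e | e <- mark_equations u] = mark_equations v.
Proof.
rewrite /mark_equations map_cat -map_comp; congr (_ ++ _).
  rewrite -map_finite_marks filter_map -map_comp; apply: eq_map => m /=.
  by rewrite -map_polR horner_map.
case: ifP => //= _; rewrite -map_polR coef_map -!map_sqfree_prod -rmorphM size_map_monic //.
by rewrite monicMr; exact: (monic_factors_prod _ _ (fun=> 1%N)).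
Qed.

(** The equations are the coefficients of one polynomial, so they all vanish under [phi] exactly
    when its image is zero. *)
Lemma map_numerator_equations :
  (forall e, e \in (numerator_equations u : seq A) -> phi e = 0) <->
  polN v = (polN v)`_(size (lowerP v)).-1 *: lowerP v.
Proof.
have sl : size (lowerP v) = size (lowerP u).
  by rewrite -map_lowerP size_map_monic //; exact: monic_factors_prod.
have E : (polN u - (polN u)`_(size (lowerP u)).-1 *: lowerP u)^phi =
    polN v - (polN v)`_(size (lowerP v)).-1 *: lowerP v.
  by rewrite rmorphB /= map_polyZ map_polN map_lowerP sl -map_polN coef_map.
rewrite /numerator_equations; split=> [h|h e].
  apply/eqP; rewrite -subr_eq0 -E; apply/eqP/polyP => i; rewrite coef_map coef0.
  set p := _ - _ in h *; case: (ltnP i (size p)) => lt.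
    by apply: h; rewrite mem_nth.
  by rewrite (nth_default _ lt); exact: rmorph0.
by move=> /(nthP 0)[i _ <-]; rewrite -coef_map E -h subrr coef0.
Qed.

End Specialization.

Section Solutions.
Variables (C : numClosedFieldType) (b : Delta -> seq nat) (mk : marking).
Variable v : 'I_(size (unknown_points b mk)) -> C.

Lemma solutionE : solution v <->
  polN v = (polN v)`_(size (lowerP v)).-1 *: lowerP v /\
  forall e, e \in mark_equations v -> e = 0.
Proof.
set X := fun i : 'I_(size (unknown_points b mk)) => 'X_i : {mpoly C[_]}.
have Xv : meval v \o X =1 v by move=> i; exact: mevalXU.
rewrite -(map_numerator_equations Xv) -(map_mark_equations Xv) /solution /equations -/X.
split=> [h|[h h'] e].
  split=> [e em|e /mapP[e' em ->]]; apply: h; rewrite mem_cat em ?orbT //.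
rewrite mem_cat => /orP[/h //|em]; apply: h'; exact: map_f.
Qed.

Lemma solution_proportional : solution v -> exists k, polN v = k *: lowerP v.
Proof. by move=> /solutionE[-> _]; eexists. Qed.

(** As [lowerP] is monic, [k] has to be the coefficient used in the equations. *)
Lemma solutionI k : polN v = k *: lowerP v ->
  (forall e, e \in mark_equations v -> e = 0) -> solution v.
Proof.
move=> E h; apply/solutionE; split=> //; rewrite {1}E; congr (_ *: _).
have /monicP : lowerP v \is monic by exact: monic_factors_prod.
by rewrite E coefZ lead_coefE => ->; rewrite mulr1.
Qed.
End Solutions.

(** * From solutions to Belyi functions *)

Section Setting.
Variables (C : numClosedFieldType) (d : nat) (b : Delta -> seq nat) (mk : marking).
Hypothesis b_gt0 : forall z, 0%N \notin b z.
Hypothesis b_sum : forall z, sumn (b z) = d.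
Hypothesis b_size : (size (b z0) + size (b z1) + size (b zoo) = d + 2)%N.
Hypothesis adm : admissible b mk.

Local Notation n := (size (unknown_points b mk)).
Implicit Types (v w : 'I_n -> C) (f : {fraction {poly C}}).

Let mk_ok : forall p : point,
  (count_mem p (marked mk) <= count_mem p (pattern_points b))%N.
Proof. by case: adm. Qed.

(** In degree 0, positive orders would leave all three collections empty, whereas two points are
    required. *)
Lemma degree_gt0 : (0 < d)%N.
Proof.
rewrite lt0n; apply: contraPneq b_size => d0.
have b0 z : size (b z) = 0%N.
  move: (b_sum z) (b_gt0 z); rewrite d0; case: (b z) => //= k l /eqP.
  by rewrite addn_eq0 in_cons => /andP[/eqP ->].
by rewrite !b0 d0.
Qed.

Lemma two_or_one_perm (l : seq nat) : two_or_one_pattern l ->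
  perm_eq l (nseq (count_mem 1%N l) 1%N ++ nseq (count_mem 2 l) 2).
Proof.
case/andP=> /allP l12 _; apply/allP => k; rewrite mem_cat => kl /=.
rewrite count_cat !count_nseq /=.
have : (k == 1%N) || (k == 2).
  case/orP: kl => [/l12 //|]; rewrite mem_cat => /orP[] /nseqP[-> _] //.
by case/orP => /eqP -> /=; rewrite ?mul1n ?mul0n ?addn0.
Qed.

Lemma atoo_pattern : (atoo mk).2 \in b (atoo mk).1.
Proof. by apply: (marked_pattern mk_ok); rewrite !inE eqxx orbT. Qed.

Definition inf_order z := if (atoo mk).1 == z then (atoo mk).2 else 0%N.

Lemma inf_order_le2 : (inf_order z1 <= 2)%N /\ (0 < inf_order (atoo mk).1)%N.
Proof.
rewrite /inf_order eqxx; split.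
  case: eqP => // e; have := atoo_pattern; rewrite e.
  by case: adm => /andP[/allP h _] _ _ /h; case: ((atoo mk).2) => [|[|[]]].
by rewrite lt0n; apply: contraTneq atoo_pattern => ->; rewrite b_gt0.
Qed.

(* Above [z = 1] every finite point has order 2. *)
Lemma fiber1_pattern : exists m,
  perm_eq (nseq m 2 ++ [seq p.2 | p <- [:: atoo mk] & p.1 == z1]) (b z1).
Proof.
case: adm => tw _ one; have pb := two_or_one_perm tw.
case/andP: tw => _ le1; have := one; have := atoo_pattern.
move: pb le1; case e1: (count_mem 1%N (b z1)) => [|[|]] //= pb _ at_b.
  (* Without a simple point, infinity may still lie above 1, with order 2; one of the entries 2 is
     then set aside for it. *)
  have n1 : 1%N \notin b z1 by apply/count_memPn.
  move=> _; move: at_b; case: eqP => [-> at_b|_ _]; last first.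
    by exists (count_mem 2 (b z1)); rewrite cats0 perm_sym.
  have a2 : (atoo mk).2 = 2 by move: at_b; rewrite (perm_mem pb) => /nseqP[].
  exists (count_mem 2 (b z1)).-1; rewrite /= a2.
  have c0 : (0 < count_mem 2 (b z1))%N by rewrite -has_count has_pred1; rewrite a2 in at_b.
  by rewrite (permPr pb) perm_catC /= -[X in perm_eq _ (nseq X 2)](prednK c0).
have b1 : 1%N \in b z1 by rewrite -has_pred1 has_count e1.
move=> /(_ b1) ->; exists (count_mem 2 (b z1)) => /=.
by rewrite perm_catC perm_sym.
Qed.

(** A finite mark of order 1 would be a second simple point above 1, next to the one at infinity,
    and the pattern has at most one. *)
Lemma finite_mark_z1 p : p \in unzip2 (finite_marks C mk) -> p.1 = z1 -> p.2 = 2.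
Proof.
case: adm => tw _ one pm pz.
have pb : p.2 \in b z1.
  rewrite -pz; apply: (marked_pattern mk_ok); move: pm.
  rewrite /unzip2 /= -map_comp map_id !inE => /orP[->//|->]; by rewrite !orbT.
case/andP: (tw) => /allP /(_ _ pb) /orP[/eqP p1|/eqP -> //] le1.
have ato : atoo mk = (z1, 1%N) by apply: one; rewrite -p1.
have Ep : p = (z1, 1%N) by case: p pz p1 {pm pb} => ? ? /= -> ->.
have := mk_ok (z1, 1%N); rewrite /= ato eqxx.
have -> : count_mem (z1, 1%N) (pattern_points b) = count_mem 1%N (b z1).
  by rewrite -[in RHS](pattern_pointsE b z1) count_map count_filter;
    apply: eq_count => -[z k]; rewrite /= xpair_eqE andbC.
move=> le; exfalso; move: pm; rewrite Ep /unzip2 /= -map_comp map_id in_cons.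
rewrite -has_pred1 has_count => h.
have : (0 < (at0 mk == (z1, 1%N)) + count_mem (z1, 1%N) (seq_of_opt (at1 mk)))%N.
  by case/orP: h => [/eqP <-|]; rewrite ?eqxx // addn_gt0 => ->; rewrite orbT.
by move: (leq_trans le le1); rewrite addnCA add1n ltnS leqn0 => /eqP ->.
Qed.

Section Nondegenerate.
Variable v : 'I_n -> C.
Hypothesis nd : nondegenerate_coefs v.

Local Notation S := (sqfree_prod v z0).
Local Notation T := (sqfree_prod v zoo).
Local Notation P := (polP v).
Local Notation Q := (polQ v).
Local Notation L := (lowerP v).
Local Notation M := (\prod_(g <- factors v zoo) g.1 ^+ g.2.-1).
Local Notation D := (dlog_num (pos_factors (factors v z0))).
Local Notation G := (dlog_num (pos_factors (factors v zoo))).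

Lemma log_deriv_P : log_deriv P S L D. Proof. exact: log_deriv_fiber (b_gt0 _). Qed.
Lemma log_deriv_Q : log_deriv Q T M G. Proof. exact: log_deriv_fiber (b_gt0 _). Qed.
Lemma polR_logR : polR v = logR S D T G. Proof. exact: polRE. Qed.
Lemma polN_logN : polN v = logN S D T G. Proof. by rewrite polNE polR_logR. Qed.

(** Here [m] counts the finite points above 1. Of the [d + 2] points one is at infinity, so
    [d + 1 - m] finite ones remain above 0 and [oo]; this is the degree of [S T]. *)
Lemma pattern_sizes : exists m, [/\
  perm_eq (nseq m 2 ++ [seq p.2 | p <- [:: atoo mk] & p.1 == z1]) (b z1),
  (m.*2 + inf_order z1 = d)%N,
  (size (S * T)%R + m = d + 2)%N,
  (size P + inf_order z0 = d.+1)%N & (size Q + inf_order zoo = d.+1)%N].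
Proof.
have [m pm] := fiber1_pattern; exists m.
have [w vw] := roots_of_coefs v.
have sm : (m.*2 + inf_order z1 = d)%N.
  rewrite -(b_sum z1) -(perm_sumn pm) sumn_cat sumn_nseq /inf_order mul2n.
  by rewrite /=; case: eqP => _ /=; rewrite ?addn0.
have km : (m + ((atoo mk).1 == z1) = size (b z1))%N.
  by rewrite -(perm_size pm) size_cat size_nseq size_map /=; case: eqP.
split=> //.
- have := size_sqfree_prod mk_ok vw (z := z0) isT.
  have := size_sqfree_prod mk_ok vw (z := zoo) isT.
  have [_ _ mS _] := log_deriv_P; have [_ _ mT _] := log_deriv_Q.
  rewrite size_mul ?monic_neq0 //.
  have : (0 < size S)%N by rewrite size_poly_gt0 monic_neq0.
  have : (0 < size T)%N by rewrite size_poly_gt0 monic_neq0.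
  have e1 : (((atoo mk).1 == z0) + ((atoo mk).1 == z1) + ((atoo mk).1 == zoo) = 1)%N.
    by case: ((atoo mk).1) => [[]|].
  by move: (size S) (size T) => *; lia.
- rewrite -(b_sum z0) -(size_full_prod mk_ok vw (z := z0) isT) //.
- rewrite -(b_sum zoo) -(size_full_prod mk_ok vw (z := zoo) isT) //.
Qed.

(** The degree of [S T] is [d + 1 - m] with [2 m <= d], and [d] is positive. *)
Lemma size_sqfree_gt2 : (2 < size (S * T)%R)%N.
Proof. by have [m [_ + + _ _]] := pattern_sizes; have := degree_gt0; lia. Qed.

Let gt2 := size_sqfree_gt2.

Lemma phiE K : phi v K = (K *: P)%:F / Q%:F. Proof. by []. Qed.

Lemma Q_neq0 : Q != 0. Proof. exact: monic_neq0 (log_deriv_monic log_deriv_Q). Qed.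

Lemma polR_numerator K : K != 0 ->
  is_numerator (fderiv (phi v K) / phi v K) (polR v).
Proof.
move=> K0; exists (S * T); rewrite polR_logR; split.
  exact: (coprimeR log_deriv_P log_deriv_Q nd).
by rewrite phiE (logR_numerator log_deriv_P log_deriv_Q).
Qed.

Lemma proportionalE K : proportional (1 - phi v K) (phi_tilde v) <->
  exists2 a : C, a != 0 & Q - K *: P = a *: polR v ^+ 2.
Proof.
rewrite /phi_tilde phiE polR_logR; exact: (proportional_fiber1 _ _ _ log_deriv_Q).
Qed.

Lemma coprime_phi K : K != 0 -> coprimep (K *: P) Q.
Proof. by move=> K0; rewrite coprimepZl //; exact: (coprimePQ log_deriv_P log_deriv_Q nd). Qed.

(** Infinity lies in at most one of the fibers of 0 and [oo], so [P] or [Q] has full degree. *)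
Lemma fdeg_phi K : K != 0 -> fdeg (phi v K) = d.
Proof.
move=> K0; rewrite phiE fdeg_frac ?coprime_phi ?Q_neq0 // size_scale //.
have [m [_ _ _]] := pattern_sizes; rewrite /inf_order.
by case: ((atoo mk).1) => [[]|] /=; move: (size P) (size Q) => *; lia.
Qed.

Lemma fiber_phi K : K != 0 -> exists2 a, a != 0 & forall y,
  fiber_poly (phi v K) y = a *: pencil (K *: P) Q y.
Proof. by move=> K0; apply: fiber_poly_frac; [exact: coprime_phi | exact: Q_neq0]. Qed.

Section Solution.
Hypothesis sol : solution v.

Let hN : exists k, logN S D T G = k *: L.
Proof. by have [k] := solution_proportional sol; rewrite polN_logN; exists k. Qed.

Lemma polN_numerator :
  is_numerator (fderiv (phi_tilde v) / phi_tilde v) (polN v).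
Proof.
have [k E] := hN; exists (polR v * T); rewrite polN_logN polR_logR; split.
  exact (solution_coprime log_deriv_P log_deriv_Q nd gt2 E).
by rewrite /phi_tilde polR_logR (logN_numerator log_deriv_P log_deriv_Q).
Qed.

Lemma mup_polN x : mup x (polN v) = (mup x P).-1.
Proof.
have [k E] := hN; rewrite polN_logN E.
have k0 := solution_k_neq0 log_deriv_P log_deriv_Q nd gt2 E.
rewrite -mul_polyC mupMr ?rootC //.
exact: (log_deriv_mup_lower log_deriv_P x (separable_left nd)).
Qed.

Lemma proportional_uniq : exists! K, proportional (1 - phi v K) (phi_tilde v).
Proof.
have [k E] := hN; have [K [a [a0 Ka]]] := solution_fiber1 log_deriv_P log_deriv_Q nd gt2 E.
exists K; split=> [|K' /proportionalE[a' a'0]].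
  by apply/proportionalE; exists a; rewrite ?polR_logR.
by rewrite polR_logR => Ka'; exact: (fiber1_uniq log_deriv_P log_deriv_Q nd gt2 Ka Ka' a'0).
Qed.

Section Constant.
Variables (K a : C).
Hypotheses (a0 : a != 0) (Ka : Q - K *: P = a *: polR v ^+ 2).

Lemma constant_neq0 : K != 0.
Proof.
have [k E] := hN; move: Ka; rewrite polR_logR.
exact: (solution_fiber1_neq0 log_deriv_P log_deriv_Q nd gt2 a0).
Qed.
Let K0 := constant_neq0.
Local Notation f := (phi v K).

Lemma fiber1_phi : exists2 c, c != 0 & fiber_poly f (pt C z1) = c *: polR v ^+ 2.
Proof.
have [e e0 Ef] := fiber_phi K0; exists (- e * a); first by rewrite mulf_neq0 ?oppr_eq0.
rewrite Ef /= scale1r -scalerA -Ka scaleNr -scalerN opprB.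
by [].
Qed.

Lemma polR_simple x : root (polR v) x -> mup x (polR v) = 1%N.
Proof.
have [k E] := hN; rewrite polR_logR => Rx.
have R'x := solution_root_simple log_deriv_P log_deriv_Q nd gt2 E Rx.
have R0 := R_neq0 log_deriv_P log_deriv_Q nd gt2; have [R'0 m'] := mup_deriv R0 Rx.
move: R'x Rx; rewrite !root_mup // m'.
by case: (mup x _) => [|[|]].
Qed.

(** Away from infinity the fiber of 1 is cut out by [R^2], so all its finite points branch. *)
Lemma root_polRE x : root (polR v) x <->
  feval f (Some x) = pt C z1 /\ (1 < ramidx f (Some x))%N.
Proof.
have R0 : polR v != 0 by rewrite polR_logR; exact: (R_neq0 log_deriv_P log_deriv_Q nd gt2).
have [c c0 Ec] := fiber1_phi.
have E : (feval f (Some x) == pt C z1) = root (polR v) x.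
  rewrite feval_eq ?fdeg_phi ?degree_gt0 // Ec ord_atZ //= expr2 mupM //.
  by rewrite addn_gt0 orbb root_mup.
split=> [Rx|[/eqP]]; last by rewrite E.
have fx : feval f (Some x) = pt C z1 by apply/eqP; rewrite E.
split=> //; rewrite ramidxE fx fdeg_phi // Ec ord_atZ //= expr2 mupM //.
by rewrite polR_simple.
Qed.

Lemma size_polR_solution m : (m.*2 + inf_order z1 = d)%N -> size (polR v) = m.+1.
Proof.
move=> md; have [m' [_ m'd sST sP sQ]] := pattern_sizes.
have {m' m'd sST} sST : (size (S * T)%R + m = d + 2)%N.
  by have <- : m' = m by move: md m'd; lia.
have [k E] := hN; have lb := solution_size log_deriv_P log_deriv_Q nd gt2 E.
have [le2 gt0] := inf_order_le2.
have [EP _ mS mL] := log_deriv_P; have [_ _ mT _] := log_deriv_Q.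
have S1 : (0 < size S)%N by rewrite size_poly_gt0 monic_neq0.
have T1 : (0 < size T)%N by rewrite size_poly_gt0 monic_neq0.
have L1 : (0 < size L)%N by rewrite size_poly_gt0 monic_neq0.
have sSL : (size P = (size S + size L).-1)%N.
  by rewrite {1}EP size_mul ?monic_neq0.
have sST' : (size (S * T)%R = (size S + size T).-1)%N.
  by rewrite size_mul ?monic_neq0.
case az: ((atoo mk).1 == z1); last first.
  have npq : size P != size Q.
    move: az sP sQ gt0; rewrite /inf_order; case: ((atoo mk).1) => [[]|] //= _;
      by move: (size P) (size Q) => *; lia.
  rewrite polR_logR (size_logR_neq log_deriv_P log_deriv_Q nd gt2 npq) sST'.
  move: md sST; rewrite sST' /inf_order az; move: (size S) (size T) => *; lia.
have [/eqP i0 /eqP ioo] : inf_order z0 == 0%N /\ inf_order zoo == 0%N.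
  by rewrite /inf_order (eqP az).
have epq : size P = size Q by move: sP sQ; rewrite i0 ioo !addn0 => -> ->.
have ub := size_logR_eq log_deriv_P log_deriv_Q nd gt2 epq.
have /solutionE[_ meq] := sol.
(* The index is [m + 1]. For order 1 at infinity the bounds already imply this equation; for order 2
   it is what excludes [deg R = m + 1]. *)
have e0 : (polR v)`_((size (S * T)%R).-1 - (atoo mk).2) = 0.
  by apply: meq; rewrite /mark_equations az mem_cat mem_head orbT.
have i1 : inf_order z1 = (atoo mk).2 by rewrite /inf_order az.
have R0 : polR v != 0 by rewrite polR_logR; exact: (R_neq0 log_deriv_P log_deriv_Q nd gt2).
have nm : size (polR v) != m.+2.
  apply: contra R0 => /eqP s2; rewrite -lead_coef_eq0 lead_coefE s2 /=.
  have <- : ((size (S * T)%R).-1 - (atoo mk).2)%N = m.+1.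
    by move: (size (S * T)%R) sST md; rewrite i1 => s; lia.
  by rewrite e0.
move: lb ub nm; rewrite -polR_logR; move: (size (polR v)) => r.
rewrite i0 in sP; move: sST sST' sSL sP S1 T1 L1.
move: (size (S * T)%R) (size S) (size T) (size L) (size P) => st s t l p.
move: (inf_order z1) le2 md => e; lia.
Qed.

Lemma uniq_proj_points w z :
    (forall p, unknown_factor v p =
       \prod_(i | tnth (in_tuple (unknown_points b mk)) i == p) ('X - (w i)%:P)) ->
    z != z1 ->
  uniq (unzip1 (proj_points w z)).
Proof.
move=> vw zz1; rewrite /unzip1 map_cat -!map_comp /= cat_uniq.
apply/and3P; split.
- rewrite (map_comp Some (fun t => t.1)) map_inj_uniq; last exact: Some_inj.
  rewrite -separable_prod_XsubC -(sqfree_prodE vw).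
  by move: nd; rewrite /nondegenerate_coefs separable_mul; case: z zz1 => [[]|] // _ /and3P[].
- by apply/hasPn => x /mapP[p _ ->]; apply/negP => /mapP[].
- by case: eqP.
Qed.

Lemma phi_fibers : exists E : Delta -> seq (option C * nat), forall z,
  [/\ perm_eq (unzip2 (E z)) (b z),
      exists2 c, c != 0 & fiber_poly f (pt C z) = c *: form (E z),
      uniq (unzip1 (E z)),
      ((atoo mk).1 = z -> (None, (atoo mk).2) \in E z)
    & forall m, m \in finite_marks C mk -> m.2.1 = z -> (Some m.1, m.2.2) \in E z].
Proof.
have [w vw] := roots_of_coefs v; have [e e0 Ef] := fiber_phi K0.
have [m [pm md _ _ _]] := pattern_sizes; have sR := size_polR_solution md.
have [r Er] := closed_field_poly_normal (polR v).
have R0 : polR v != 0 by rewrite polR_logR; exact: (R_neq0 log_deriv_P log_deriv_Q nd gt2).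
have lR0 : lead_coef (polR v) != 0 by rewrite lead_coef_eq0.
have sr : size r = m by move: sR; rewrite Er size_scale // size_prod_XsubC => -[].
have ur : uniq r.
  have : separable_poly (polR v).
    rewrite unlock; apply: Pdiv.ClosedField.root_coprimep => x Rx.
    have [k hk] := hN; rewrite polR_logR in Rx *.
    exact: (solution_root_simple log_deriv_P log_deriv_Q nd gt2 hk Rx).
  rewrite -separable_prod_XsubC {1}Er unlock derivZ.
  by rewrite coprimepZl // coprimepZr.
(* The finite points above 1 are the simple roots of [R], each doubled by the square. *)
pose E1 : seq (option C * nat) := [seq (Some x, 2) | x <- r] ++
  [seq (None, p.2) | p <- [:: atoo mk] & p.1 == z1].
have perm1 : perm_eq (unzip2 E1) (b z1).
  rewrite -(permPr pm) /unzip2 /E1 map_cat -!map_comp -sr; apply: perm_cat => //.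
  by elim: (r) => //= x s IH; rewrite perm_cons.
have uniq1 : uniq (unzip1 E1).
  rewrite /unzip1 map_cat -!map_comp /= cat_uniq; apply/and3P; split.
  - by rewrite map_inj_uniq //; exact: Some_inj.
  - by apply/hasPn => x /mapP[p _ ->]; apply/negP => /mapP[].
  - by case: eqP.
have form1 : form E1 = (\prod_(x <- r) ('X - x%:P)) ^+ 2.
  rewrite /form /E1 big_cat big_map /= prodrXl [X in _ * X]big1_seq ?mulr1 //.
  by move=> y /mapP[p _ ->]; exact: expr1n.
have marksf z y : y \in finite_marks C mk -> y.2.1 = z ->
    (Some y.1, y.2.2) \in proj_points w z.
  move=> ym yz; rewrite mem_cat; apply/orP; left; apply/mapP; exists y => //.
  by rewrite mem_filter yz eqxx mem_cat ym orbT.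
have infp z s : (atoo mk).1 = z ->
    (None, (atoo mk).2) \in s ++ [seq (None : option C, p.2) | p <- [:: atoo mk] & p.1 == z].
  by move=> <-; rewrite mem_cat /= eqxx /= inE eqxx orbT.
exists (fun z => if z == z1 then E1 else proj_points w z) => -[[]|] /=.
- split=> //; last 2 first.
  + exact: infp.
  + move=> y ym yz; have y2 : y.2.2 = 2.
      by apply: finite_mark_z1 yz; apply: map_f.
    rewrite y2 mem_cat; apply/orP; left; apply/mapP; exists y.1 => //.
    rewrite -root_prod_XsubC; have <- : root (polR v) y.1 =
      root (\prod_(x <- r) ('X - x%:P)) y.1 by rewrite {1}Er rootZ.
    (* That a finite mark above 1 is a root of [R] is one of the mark equations. *)
    apply/eqP; have /solutionE[_] := sol; apply; rewrite mem_cat; apply/orP; left.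
    by apply/mapP; exists y => //; rewrite mem_filter yz eqxx.
  have [c c0 Ec] := fiber1_phi; exists (c * lead_coef (polR v) ^+ 2).
    by rewrite mulf_neq0 ?expf_neq0.
  rewrite form1 -scalerA -exprZn -Er; exact: Ec.
- split; [exact: perm_proj_points | | exact: uniq_proj_points | exact: infp |exact: marksf].
  exists (e * K); first by rewrite mulf_neq0.
  transitivity (e *: pencil (K *: P) Q (pt C z0)); first exact: (Ef (Some 0)).
  by rewrite /= scale0r subr0 scalerA -(full_prodE vw).
- split; [exact: perm_proj_points | | exact: uniq_proj_points | exact: infp |exact: marksf].
  exists e => //; transitivity (e *: pencil (K *: P) Q (pt C zoo)); first exact: (Ef None).
  by rewrite /= -(full_prodE vw).
Qed.

Lemma phi_belyi : belyi_with_orders d b f /\ respects_marking mk f.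
Proof.
have [E EP] := phi_fibers; have df : (0 < fdeg f)%N by rewrite fdeg_phi ?degree_gt0.
have fib z : fiber_orders f (pt C z) (unzip2 (E z)) /\
    forall e, e \in E z -> feval f e.1 = pt C z /\ ramidx f e.1 = e.2.
  have [pE [c c0 Ec] uE _ _] := EP z.
  apply: (fiber_ordersI df c0 Ec uE); first by rewrite (perm_mem pE) b_gt0.
  by rewrite (perm_sumn pE) b_sum fdeg_phi.
have inf : has_point f None (atoo mk).
  have [_ _ _ /(_ erefl) iE _] := EP (atoo mk).1.
  by have [_ /(_ _ iE)] := fib (atoo mk).1.
have fin m : m \in finite_marks C mk -> has_point f (Some m.1) m.2.
  move=> mm; have [_ _ _ _ /(_ _ mm erefl) iE] := EP m.2.1.
  by have [_ /(_ _ iE)] := fib m.2.1.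
split; last first.
  split=> //; first by apply: (fin (0, at0 mk)); rewrite mem_head.
  move=> p a1; apply: (fin (1, p)); rewrite in_cons; apply/orP; right.
  by apply/mapP; exists p; rewrite // a1 mem_head.
split; first exact: fdeg_phi.
- case=> [x|] r1; last by exists (atoo mk).1; case: inf.
  have [e e0 Ef] := fiber_phi K0.
  have evE y : (feval f (Some x) == y) = root (fiber_poly f y) x.
    by rewrite feval_eq //= root_mup ?fiber_poly_neq0.
  move: r1; rewrite ramidxE; case fx: (feval f (Some x)) => [s|] r1; last first.
    by exists zoo.
  have g0 : fiber_poly f (Some s) != 0 by exact: fiber_poly_neq0.
  have gx : root (fiber_poly f (Some s)) x by rewrite root_mup //; exact: ltnW r1.
  have [g'0 mg'] := mup_deriv g0 gx.
  have g'x : root (fiber_poly f (Some s))^`() x.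
    by rewrite root_mup // mg' -subn1 subn_gt0.
  (* A multiple point of a fiber is a zero of the Wronskian of its form with [Q]. This is a constant
     multiple of that of [P] and [Q], hence of [L M R], whose roots lie above 0, [oo] and 1. *)
  have : root (wronsk (fiber_poly f (Some s)) Q) x.
    by rewrite rootE /wronsk hornerD hornerN !hornerM (rootP gx) (rootP g'x)
      !mul0r subrr.
  rewrite Ef /= wronskZl wronskBl !wronskZl wronskpp scaler0 subr0 rootZ // rootZ //.
  rewrite (wronskPQ log_deriv_P log_deriv_Q) -polR_logR !rootM -orbA.
  case/or3P => [Lx|Mx|Rx].
  + exists z0; apply/eqP; rewrite -fx evE Ef /= scale0r subr0 !rootZ //.
    by have [-> _ _ _] := log_deriv_P; rewrite rootM Lx orbT.
  + exists zoo; apply/eqP; rewrite -fx evE Ef /= rootZ //.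
    by have [-> _ _ _] := log_deriv_Q; rewrite rootM Mx orbT.
  + by exists z1; rewrite -fx; case: (proj1 (root_polRE x) Rx).
- move=> z; have [[xs [u m p]] _] := fib z; exists xs; split=> //.
  by have [pE _ _ _ _] := EP z; apply: perm_trans p pE.
Qed.
End Constant.
End Solution.
End Nondegenerate.
End Setting.

(** * From Belyi functions to solutions *)

(** Serves to list the actual points of a function in the order prescribed for their kinds. *)
Lemma perm_map_lift (T U : eqType) (g : T -> U) (s : seq T) (t : seq U) :
  perm_eq (map g s) t -> exists2 s', perm_eq s' s & map g s' = t.
Proof.
elim: t s => [|u t IH] s pst.
  by exists [::] => //; move: (perm_size pst); rewrite size_map; case: s {pst}.
have : u \in map g s by rewrite (perm_mem pst) mem_head.
case/mapP => x xs ux; have ps := perm_to_rem xs.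
have /IH [s' ps' gs'] : perm_eq (map g (rem x s)) t.
  by rewrite -(perm_cons u) {1}ux -map_cons -(permPl (perm_map g ps)).
exists (x :: s'); last by rewrite /= gs' ux.
by rewrite (permPr ps) perm_cons.
Qed.

Lemma count_gt1 (T : eqType) (P : pred T) (s : seq T) x y :
  x \in s -> y \in s -> x != y -> P x -> P y -> (1 < count P s)%N.
Proof.
move=> xs ys xy Px Py; rewrite (permP (perm_to_rem xs)) /= Px add1n ltnS.
rewrite -has_count; apply/hasP; exists y => //.
move: ys; rewrite (perm_mem (perm_to_rem xs)) in_cons eq_sym.
by rewrite (negPf xy).
Qed.

Section FromBelyi.
Variables (C : numClosedFieldType) (d : nat) (b : Delta -> seq nat) (mk : marking).
Hypothesis b_gt0 : forall z, 0%N \notin b z.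
Hypothesis b_sum : forall z, sumn (b z) = d.
Hypothesis b_size : (size (b z0) + size (b z1) + size (b zoo) = d + 2)%N.
Hypothesis adm : admissible b mk.
Variable f : {fraction {poly C}}.
Hypothesis fbelyi : belyi_with_orders d b f.
Hypothesis fmarks : respects_marking mk f.

Local Notation unk := (unknown_points b mk).
Local Notation n := (size unk).
Local Notation kind := (tnth (in_tuple unk)).

Let mk_ok : forall p : point,
  (count_mem p (marked mk) <= count_mem p (pattern_points b))%N.
Proof. by case: adm. Qed.

Let dgt0 : (0 < d)%N := degree_gt0 b_gt0 b_sum b_size.
Let fd : fdeg f = d. Proof. by case: fbelyi. Qed.
Let fdgt0 : (0 < fdeg f)%N. Proof. by rewrite fd. Qed.

Lemma pt_inj : injective (pt C).
Proof.
case=> [[]|] [[]|] //= /Some_inj /eqP; rewrite ?(eq_sym 0) oner_eq0 //.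
Qed.

Definition marks : seq (option C * point) :=
  (None, atoo mk) :: [seq (Some m.1, m.2) | m <- finite_marks C mk].

Lemma marks_uniq : uniq (unzip1 marks).
Proof.
rewrite /marks /finite_marks /=; case: (at1 mk) => [p|] //=.
by rewrite !inE /= (inj_eq Some_inj) eq_sym oner_eq0.
Qed.

Lemma marks_marked : perm_eq (unzip2 marks) (marked mk).
Proof.
rewrite /marks /finite_marks /marked /=; case: (at1 mk) => [p|] /=;
apply/permP => q /=; lia.
Qed.

Lemma marks_points t : t \in marks -> has_point f t.1 t.2.
Proof.
case: fmarks => h0 h1 hoo; rewrite in_cons => /orP[/eqP -> //|].
rewrite /finite_marks /= in_cons => /orP[/eqP -> //|].
case/mapP => m /mapP[p pa ->] ->; apply: h1.
by case: (at1 mk) pa => // q; rewrite inE => /eqP ->.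
Qed.

Variable E : Delta -> seq (option C * nat).
Hypothesis uE : forall z, uniq (unzip1 (E z)).
Hypothesis pE : forall z, perm_eq (unzip2 (E z)) (b z).
Hypothesis fE : forall z, fiber_poly f (pt C z) =
  lead_coef (fiber_poly f (pt C z)) *: form (E z).
Hypothesis mE : forall z x, (x \in unzip1 (E z)) = (feval f x == pt C z).
Hypothesis vE : forall z e, e \in E z -> feval f e.1 = pt C z /\ ramidx f e.1 = e.2.

Lemma mem_fiber z x k : ((x, k) \in E z) = (feval f x == pt C z) && (ramidx f x == k).
Proof.
apply/idP/andP => [/vE [-> ->]//|[fx /eqP <-]].
have : x \in unzip1 (E z) by rewrite mE.
by case/mapP => -[y l] yE /= ->; have [_ /= ->] := vE yE.
Qed.

(** The fiber of 1 is left out because the ansatz has no unknown points there. *)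
Definition fiber_points : seq (option C * point) :=
  [seq (e.1, (z0, e.2)) | e <- E z0] ++ [seq (e.1, (zoo, e.2)) | e <- E zoo].

Lemma mem_fiber_points t : (t \in fiber_points) =
  [&& t.2.1 != z1, feval f t.1 == pt C t.2.1 & ramidx f t.1 == t.2.2].
Proof.
case: t => x [z k] /=; have mm z' : ((x, (z, k)) \in
    [seq (e.1, (z', e.2)) | e <- E z']) = (z == z') && ((x, k) \in E z').
  apply/mapP/andP => [[[y l] yE [-> -> ->]]|[/eqP -> xE]]; first by rewrite eqxx.
  by exists (x, k).
rewrite mem_cat !mm !mem_fiber; case: z {mm} => [[]|] //=.
by rewrite orbF.
Qed.

Lemma fiber_points_uniq : uniq (unzip1 fiber_points).
Proof.
rewrite /unzip1 map_cat -!map_comp cat_uniq; apply/and3P; split; [exact: uE | | exact: uE].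
apply/hasPn => x /mapP[e /vE[fe _] ->] /=; apply/negP => /mapP[e' /vE[fe' _]] /= ee.
by move: fe'; rewrite -ee fe => /pt_inj.
Qed.

Definition unmarked := [seq t <- fiber_points | t.1 \notin unzip1 marks].
Definition marks01 := [seq t <- marks | t.2.1 != z1].

(** A point has one value and one order, so an entry located at a marked point coincides with the
    mark. *)
Lemma perm_fiber_points : perm_eq (marks01 ++ unmarked) fiber_points.
Proof.
have uf := map_uniq fiber_points_uniq; have um := map_uniq marks_uniq.
apply: uniq_perm => //.
  rewrite cat_uniq !filter_uniq //= andbT; apply/hasPn => t.
  rewrite mem_filter => /andP[tm _]; apply: contra tm.
  by rewrite mem_filter => /andP[_ tm]; apply: map_f.
move=> t; rewrite mem_cat !mem_filter.
apply/orP/idP => [[/andP[tz /marks_points[f1 f2]]|/andP[]//]|tf].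
  by rewrite mem_fiber_points tz f1 f2 !eqxx.
case: (boolP (t.1 \in unzip1 marks)) => [tM|_]; [left; move: tM | by right].
case/mapP => m mm tm; move: tf; rewrite mem_fiber_points => /and3P[tz /eqP f1 /eqP f2].
have [g1 g2] := marks_points mm.
suff -> : t = m by rewrite -?tm mm andbT; move: g1; rewrite -tm f1 => /pt_inj <-.
case: t m tm f1 f2 g1 g2 {mm tz} => x [z k] [y [z' k']] /= -> -> -> /pt_inj -> ->.
by [].
Qed.

(** The marked kinds are cancelled on both sides, from the list of points and from the pattern. *)
Lemma perm_unmarked : perm_eq (unzip2 unmarked) unk.
Proof.
have p2 : perm_eq (unzip2 fiber_points) [seq p <- pattern_points b | p.1 != z1].
  have -> : [seq p <- pattern_points b | p.1 != z1] =
      [seq (z0, k) | k <- b z0] ++ [seq (zoo, k) | k <- b zoo].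
    have fl z' (l : seq nat) : [seq p <- [seq (z', k) | k <- l] | p.1 != z1] =
        if z' == z1 then [::] else [seq (z', k) | k <- l].
      by elim: l => [|k l] /=; case: (z' == z1) => //= ->.
    by rewrite /pattern_points /= !filter_cat !fl /= cats0.
  rewrite /unzip2 map_cat -!map_comp; apply: perm_cat.
    by rewrite -(permPr (perm_map _ (pE z0))) /unzip2 -map_comp.
  by rewrite -(permPr (perm_map _ (pE zoo))) /unzip2 -map_comp.
have p1 : perm_eq (unzip2 marks01) [seq p <- marked mk | p.1 != z1].
  by rewrite -(permPr (perm_filter _ marks_marked)) filter_map.
have := perm_filter (fun p => p.1 != z1) (perm_foldr_rem mk_ok).
rewrite filter_cat -(permPr p2) -(permPr (perm_map _ perm_fiber_points)) map_cat.
rewrite -(permPl (perm_cat p1 (perm_refl _))) perm_cat2l perm_sym.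
by [].
Qed.

Lemma exists_labels : exists w : 'I_n -> C,
  perm_eq [seq (Some (w i), kind i) | i <- enum 'I_n] unmarked.
Proof.
have [s ps us] := perm_map_lift perm_unmarked.
have ss : size s = n by rewrite -us size_map.
(* Infinity is marked, so the unmarked points are finite and the default 0 is never met. *)
pose w (i : 'I_n) := odflt 0 (nth (None, (zoo, 0%N)) s i).1; exists w.
suff -> : [seq (Some (w i), kind i) | i <- enum 'I_n] = s by [].
apply: (@eq_from_nth _ (None, (zoo, 0%N))); first by rewrite size_map size_enum_ord.
move=> i; rewrite size_map size_enum_ord => lt.
rewrite (nth_map (Ordinal lt)) ?size_enum_ord //.
set j := nth _ _ _; have ji : j = Ordinal lt by apply: val_inj; rewrite /= nth_enum_ord.
rewrite /w ji /= (tnth_nth (zoo, 0%N)) /=.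
have si : nth (None, (zoo, 0%N)) s i \in s by rewrite mem_nth // ss.
have : nth (None, (zoo, 0%N)) s i \in unmarked by rewrite -(perm_mem ps).
rewrite mem_filter => /andP[+ _]; rewrite /marks /= in_cons negb_or => /andP[n0 _].
have <- : (nth (None, (zoo, 0%N)) s i).2 = nth (zoo, 0%N) unk i.
  by rewrite -us (nth_map (None, (zoo, 0%N))) ?ss.
by case: (nth _ s i) n0 => -[x|] q.
Qed.

Section Coefs.
Variables (w v : 'I_n -> C).
Hypothesis pw : perm_eq [seq (Some (w i), kind i) | i <- enum 'I_n] unmarked.
Hypothesis vw : forall p, unknown_factor v p = \prod_(i | kind i == p) ('X - (w i)%:P).

Lemma perm_proj_fiber z : z != z1 -> perm_eq (proj_points w z) (E z).
Proof.
move=> zz1.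
have -> : proj_points w z = [seq (t.1, t.2.2) |
    t <- [seq (Some t.1, t.2) | t <- labelled w] ++ [:: (None, atoo mk)] & t.2.1 == z].
  rewrite filter_cat map_cat filter_map -map_comp; congr (_ ++ _).
  by rewrite /=; case: eqP.
have -> : E z = [seq (t.1, t.2.2) | t <- fiber_points & t.2.1 == z].
  have fl z' (l : seq (option C * nat)) :
      [seq (t.1, t.2.2) | t <- [seq (e.1, (z', e.2)) | e <- l] & t.2.1 == z] =
      if z' == z then l else [::].
    by elim: l => [|[x k] l] /=; case: (z' == z) => //= ->.
  by rewrite filter_cat map_cat !fl; case: z zz1 {fl} => [[]|] //=; rewrite cats0.
apply: perm_map; rewrite -(permPr (perm_filter _ perm_fiber_points)).
have -> : [seq t <- marks01 ++ unmarked | t.2.1 == z] =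
          [seq t <- marks ++ unmarked | t.2.1 == z].
  rewrite !filter_cat; congr (_ ++ _); rewrite -filter_predI; apply: eq_filter => t /=.
  by case: eqP => // ->.
apply: perm_filter; rewrite /labelled map_cat -map_comp -catA perm_sym.
rewrite perm_catC; apply: perm_cat; first by rewrite perm_sym.
by rewrite /marks -cat1s perm_catC.
Qed.

Lemma full_prod_fiber z : z != z1 -> full_prod v z = form (E z).
Proof. by move=> zz1; rewrite (full_prodE vw) /form (perm_big _ (perm_proj_fiber zz1)). Qed.

Lemma nondegenerate_fiber : nondegenerate_coefs v.
Proof.
rewrite /nondegenerate_coefs !(sqfree_prodE vw) -big_cat separable_prod_XsubC.
rewrite -(map_inj_uniq (f := Some) Some_inj) map_cat.
have sub z : subseq (map Some [seq t.1 | t <- labelled w & t.2.1 == z])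
                    (unzip1 (proj_points w z)).
  rewrite /unzip1 map_cat -!map_comp; exact: prefix_subseq.
apply: (subseq_uniq (cat_subseq (sub z0) (sub zoo))).
have -> : uniq (unzip1 (proj_points w z0) ++ unzip1 (proj_points w zoo)) =
          uniq (unzip1 (E z0) ++ unzip1 (E zoo)).
  by apply: perm_uniq; apply: perm_cat; apply: perm_map; apply: perm_proj_fiber.
by have := fiber_points_uniq; rewrite /unzip1 map_cat -!map_comp.
Qed.

(** Numerator and denominator of [f] are its fiber forms at 0 and [oo], which split over the points
    from which [P] and [Q] are built; [K] is the ratio of their leading coefficients. *)
Lemma f_phi : exists2 K, K != 0 & f = phi v K.
Proof.
have l0 z : lead_coef (fiber_poly f (pt C z)) != 0.
  by rewrite lead_coef_eq0 fiber_poly_neq0.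
exists (lead_coef (fiber_poly f (pt C z0)) / lead_coef (fiber_poly f (pt C zoo))).
  by rewrite mulf_neq0 ?invr_eq0.
rewrite [LHS]fracE phiE; apply/eqP; rewrite eq_frac ?fden_neq0 //; last first.
  by rewrite /polQ full_prod_fiber ?form_neq0.
have En : fnum f = lead_coef (fiber_poly f (pt C z0)) *: polP v.
  rewrite /polP full_prod_fiber // -fE.
  by rewrite /= scale0r subr0.
have Ed : fden f = lead_coef (fiber_poly f (pt C zoo)) *: polQ v.
  by rewrite /polQ full_prod_fiber // -fE.
by rewrite En Ed -!scalerAl -!scalerAr !scalerA divfK.
Qed.

(** An order 1 above 1 forces a simple point at infinity, so a finite simple point would be the
    second one. *)
Lemma fiber1_order e : e \in E z1 -> e.1 != None -> e.2 = 2.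
Proof.
move=> eE e0; have eb : e.2 \in b z1 by rewrite -(perm_mem (pE z1)); apply: map_f.
case: adm => /andP[/allP /(_ _ eb) /orP[/eqP e1|/eqP -> //] le1] _ one.
have at1 : atoo mk = (z1, 1%N) by apply: one; rewrite -e1.
have [_ _ [f1 f2]] := fmarks.
have iE : (None, 1%N) \in E z1 by rewrite mem_fiber f1 f2 at1 !eqxx.
have : (1 < count_mem 1%N (b z1))%N.
  rewrite -(permP (pE z1)) count_map; apply: (count_gt1 eE iE) => //=.
    by apply: contra_neq e0 => ->.
  by rewrite e1.
by rewrite ltnNge le1.
Qed.

Definition sqrt_fiber1 : {poly C} := \prod_(e <- E z1 | e.1 != None) lin e.1.
Local Notation W := sqrt_fiber1.

Lemma form_fiber1 : form (E z1) = W ^+ 2.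
Proof.
rewrite /form (bigID (fun e => e.1 == None)) /= big1 ?mul1r; last first.
  by case=> [[x|] k] //= _; rewrite expr1n.
rewrite /W -prodrXl big_seq_cond [RHS]big_seq_cond.
by apply: eq_bigr => e /andP[eE e0]; rewrite (fiber1_order eE).
Qed.

(** The fiber form of degree [d] vanishes to order [inf_order mk z1] at infinity, so its finite part
    [W^2] has degree [2 m]. *)
Lemma size_sqrt_fiber1 m : (m.*2 + inf_order mk z1 = d)%N -> size W = m.+1.
Proof.
move=> md; have sE : sumn (unzip2 (E z1)) = d by rewrite (perm_sumn (pE z1)).
have l0 : lead_coef (fiber_poly f (pt C z1)) != 0.
  by rewrite lead_coef_eq0 fiber_poly_neq0.
have W0 : W != 0.
  by have := form_neq0 (E z1); rewrite form_fiber1 expf_eq0.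
have inf : (\sum_(e <- E z1 | e.1 == None) e.2)%N = inf_order mk z1.
  rewrite -(ord_at_form _ _ l0) sE -fE -{1}fd /inf_order.
  have [_ _ [f1 f2]] := fmarks; case: eqP => [az|az].
    by rewrite -f2 ramidxE f1 az.
  apply/eqP; rewrite -leqn0 leqNgt -feval_eq // f1.
  by apply/negP => /eqP /pt_inj.
have := size_form (E z1); rewrite form_fiber1 expr2 size_mul //.
have : ((\sum_(e <- E z1 | e.1 != None) e.2) + inf_order mk z1 = d)%N.
  rewrite -sE sumnE big_map [RHS](bigID (fun e => e.1 == None)) /= inf addnC.
  by [].
move: md W0; rewrite -size_poly_gt0; move: (size W) (\sum_(e <- E z1 | e.1 != None) e.2)%N => s t.
lia.
Qed.

Lemma output_belyi : output b mk f.
Proof.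
have [K K0 fphi] := f_phi; exists v, K.
have nd := nondegenerate_fiber.
have log_deriv_P := log_deriv_P b_gt0 adm v; have log_deriv_Q := log_deriv_Q b_gt0 adm v.
have gt2 := size_sqfree_gt2 b_gt0 b_sum b_size adm v.
have [m [_ md sST sP sQ]] := pattern_sizes b_gt0 b_sum b_size adm v.
have sW := size_sqrt_fiber1 md.
have [c c0 Ef] := fiber_phi b_gt0 adm nd K0.
have l0 : lead_coef (fiber_poly f (pt C z1)) != 0.
  by rewrite lead_coef_eq0 fiber_poly_neq0.
set l := lead_coef _ in l0.
(* The fiber form of 1 is computed twice: as [c (K P - Q)] from the pencil and as [l W^2] from the
   points. *)
have EW : polQ v - K *: polP v = (- (l / c)) *: W ^+ 2.
  rewrite -form_fiber1 scaleNr mulrC -scalerA -(fE z1) fphi (Ef (pt C z1)).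
  by rewrite scalerA mulVf // scale1r /= scale1r opprB.
have a0 : - (l / c) != 0 by rewrite oppr_eq0 mulf_neq0 ?invr_eq0.
have bnd := square_fiber_size log_deriv_P log_deriv_Q nd gt2 K0 a0 EW.
have RE := polR_logR v.
have [le2 gt0] := inf_order_le2 b_gt0 adm.
(* With infinity above 1, the upper bound from the square fiber evaluates to [deg R <= m]; otherwise
   the exact degree of [R] is [m]. *)
have sRW : (size (polR v) <= size W)%N.
  rewrite sW; case az: ((atoo mk).1 == z1).
    have i0 : inf_order mk z0 = 0%N by rewrite /inf_order (eqP az).
    move: bnd sP sST; rewrite RE sW i0.
    by move: (size (logR _ _ _ _)) (size (polP v)) (size (sqfree_prod v z0 * sqfree_prod v zoo)%R) => *; lia.
  have npq : size (polP v) != size (polQ v).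
    move: az sP sQ gt0; rewrite /inf_order; case: ((atoo mk).1) => [[]|] //= _;
      by move: (size (polP v)) (size (polQ v)) => *; lia.
  rewrite RE (size_logR_neq log_deriv_P log_deriv_Q nd gt2 npq).
  move: md sST; rewrite /inf_order az; move: (size (sqfree_prod v z0 * sqfree_prod v zoo)%R) => *; lia.
rewrite RE in sRW.
have [[k hk] [r r0 hr]] := square_fiber_solution log_deriv_P log_deriv_Q nd gt2 K0 a0 EW sRW.
rewrite -RE in hr; have sR : size (polR v) = m.+1 by rewrite hr size_scale.
split=> //.
- apply: (solutionI (k := k)); first by rewrite (polN_logN v).
  move=> e; rewrite mem_cat => /orP[/mapP[y]|].
    rewrite mem_filter => /andP[/eqP yz ym] ->; apply/rootP.
    have ymk : (Some y.1, y.2) \in marks by rewrite in_cons (map_f (fun y => (Some y.1, y.2))) ?orbT.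
    have [y1 y2] := marks_points ymk.
    have : (Some y.1) \in unzip1 (E z1) by rewrite mE y1 yz.
    case/mapP => u uE1 uy; rewrite hr rootZ // rootE /W horner_prod.
    rewrite (big_rem u uE1) /= -uy /= hornerXsubC subrr mul0r eqxx //.
  case: ifP => // az; rewrite inE => /eqP ->.
  (* The equation at infinity concerns the coefficient of index [m + 1], beyond the degree of
     [R]. *)
  rewrite nth_default // sR; move: md sST; rewrite /inf_order az.
  by move: (size (sqfree_prod v z0 * sqfree_prod v zoo)%R) => *; lia.
- apply/(proportionalE b_gt0 adm); exists (- (l / c) / r ^+ 2).
    by rewrite mulf_neq0 ?invr_eq0 ?expf_neq0.
  by rewrite EW hr exprZn scalerA divfK ?expf_neq0.
Qed.

End Coefs.
End FromBelyi.

Lemma belyi_output (C : numClosedFieldType) (d : nat) (b : Delta -> seq nat)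
    (mk : marking) (f : {fraction {poly C}}) :
    (forall z, 0%N \notin b z) -> (forall z, sumn (b z) = d) ->
    (size (b z0) + size (b z1) + size (b zoo) = d + 2)%N -> admissible b mk ->
  belyi_with_orders d b f -> respects_marking mk f -> output b mk f.
Proof.
move=> b0 bs bz adm fb fm; have dgt0 := degree_gt0 b0 bs bz.
have [fd _ fo] := fb; have fd0 : (0 < fdeg f)%N by rewrite fd.
have ex z := fiber_ordersE fd0 (fo z).
have [E0 [u0 p0 f0 m0 v0]] := ex z0.
have [E1 [u1 p1 f1 m1 v1]] := ex z1.
have [Eoo [uoo poo foo moo voo]] := ex zoo.
pose E (z : Delta) := if z is Some x then if x then E1 else E0 else Eoo.
have uE z : uniq (unzip1 (E z)) by case: z => [[]|].
have pE z : perm_eq (unzip2 (E z)) (b z) by case: z => [[]|].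
have fE z : fiber_poly f (pt C z) =
  lead_coef (fiber_poly f (pt C z)) *: form (E z) by case: z => [[]|].
have mE z x : (x \in unzip1 (E z)) = (feval f x == pt C z).
  by case: z => [[]|]; [exact: m1 | exact: m0 | exact: moo].
have vE z e : e \in E z -> feval f e.1 = pt C z /\ ramidx f e.1 = e.2.
  by case: z => [[]|]; [exact: v1 | exact: v0 | exact: voo].
have [w pw] := exists_labels b0 bs bz adm fb fm uE pE mE vE.
have [v vw] := coefs_of_roots w.
exact: (output_belyi b0 bs bz adm fb fm uE pE fE mE vE pw vw).
Qed.

(** * Changes of coordinates *)

Lemma fiber_orders_transport (C : fieldType) (f g : {fraction {poly C}})
    (m m' : option C -> option C) y l :
    bijective m -> injective m' ->
    (forall x, feval g x = m' (feval f (m x)) /\ ramidx g x = ramidx f (m x)) ->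
  fiber_orders f y l -> fiber_orders g (m' y) l.
Proof.
move=> [mi mK miK] m'_inj gE [xs [uxs mxs pxs]]; exists [seq mi x | x <- xs]; split.
- by rewrite map_inj_uniq //; exact: can_inj miK.
- move=> x; rewrite -{1}[x]mK (mem_map (can_inj miK)) mxs.
  by rewrite (proj1 (gE x)) (inj_eq m'_inj).
- rewrite -map_comp (eq_map (g := ramidx f)) // => x /=.
  by rewrite (proj2 (gE _)) miK.
Qed.

Lemma card_Delta : #|{: Delta}| = 3.
Proof. by rewrite card_option card_bool. Qed.

Lemma sum_Delta (F : Delta -> nat) : (\sum_z F z = F z0 + F z1 + F zoo)%N.
Proof.
rewrite (bigD1 z0) //= (bigD1 z1) //= (big_pred1 zoo) ?addnA // => z.
by case: z => [[]|].
Qed.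

Lemma Delta_bij (s : Delta -> 'I_3) : injective s -> bijective s.
Proof. by move=> si; apply: inj_card_bij => //; rewrite card_ord card_Delta. Qed.

Lemma sum_reindex_Delta (s : Delta -> 'I_3) (F : 'I_3 -> nat) : injective s ->
  (\sum_i F i = F (s z0) + F (s z1) + F (s zoo))%N.
Proof.
move=> /Delta_bij s_bij.
by rewrite (reindex s) /= ?(sum_Delta (fun z => F (s z))) //; exact: onW_bij.
Qed.

(** The points chosen for the marks are distinct, so a transformation takes 0, 1 and infinity to
    them; if none is chosen for [x = 1], some third point takes its place. *)
Lemma belyi_moebius (C : numClosedFieldType) (d : nat) (b : Delta -> seq nat)
    (mk : marking) (f : {fraction {poly C}}) :
    (0 < d)%N -> (size (b z0) + size (b z1) + size (b zoo) = d + 2)%N ->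
    (forall p, count_mem p (marked mk) <= count_mem p (pattern_points b))%N ->
    belyi_with_orders d b f ->
  exists m g, [/\ moebius_map m, forall x, feval g x = feval f (m x),
    belyi_with_orders d b g & respects_marking mk g].
Proof.
move=> dgt0 bz mk_ok fb; have [fd fram fo] := fb.
have fd0 : (0 < fdeg f)%N by rewrite fd.
have ex z := fiber_ordersE fd0 (fo z).
have [E0 [u0 p0 _ _ v0]] := ex z0.
have [E1 [u1 p1 _ _ v1]] := ex z1.
have [Eoo [uoo poo _ _ voo]] := ex zoo.
pose A := [seq (e.1, (z0, e.2)) | e <- E0] ++ [seq (e.1, (z1, e.2)) | e <- E1] ++
  [seq (e.1, (zoo, e.2)) | e <- Eoo].
have vA t : t \in A -> has_point f t.1 t.2.
  by rewrite !mem_cat => /or3P[] /mapP[e]; [move/v0 | move/v1 | move/voo] => -[??] ->.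
have pA : perm_eq (unzip2 A) (pattern_points b).
  rewrite /pattern_points /= cats0 /unzip2 !map_cat -!map_comp.
  apply: perm_cat; last apply: perm_cat.
  - by rewrite -(permPr (perm_map _ p0)) -map_comp.
  - by rewrite -(permPr (perm_map _ p1)) -map_comp.
  - by rewrite -(permPr (perm_map _ poo)) -map_comp.
have uA : uniq (unzip1 A).
  rewrite /unzip1 !map_cat -!map_comp !cat_uniq u0 u1 uoo !andbT /=.
  have disj z z' (l l' : seq (option C * nat)) : z != z' ->
     (forall e, e \in l -> feval f e.1 = pt C z /\ ramidx f e.1 = e.2) ->
     (forall e, e \in l' -> feval f e.1 = pt C z' /\ ramidx f e.1 = e.2) ->
     forall x, x \in map fst l -> x \in map fst l' -> False.
    move=> zz vl vl' x /mapP[e /vl[fe _] ->] /mapP[e' /vl'[fe' _] ee].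
    by move: zz; rewrite (pt_inj (C := C) (x1 := z) (x2 := z')) ?eqxx // -fe -fe' ee.
  apply/andP; split; apply/hasPn => x; last first.
    by move=> xo; apply/negP => x1; exact: (disj z1 zoo E1 Eoo _ v1 voo x).
  rewrite mem_cat => xo; apply/negP => x0; case/orP: xo => xo.
    exact: (disj z0 z1 E0 E1 _ v0 v1 x).
  exact: (disj z0 zoo E0 Eoo _ v0 voo x).
(* All points of the three fibers, beginning with those for 0, for infinity and, if it is marked,
   for 1. *)
have [t pt t2] : exists2 t, perm_eq t A & unzip2 t = marked mk ++
    foldr (fun x s => rem x s) (pattern_points b) (marked mk).
  apply: perm_map_lift; apply: perm_trans pA _.
  by rewrite perm_sym perm_foldr_rem.
(* There are [d + 2], hence at least three, points, so a third one exists even if the marking omits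
   [x = 1]. *)
have st : (2 < size t)%N.
  have -> : size t = (d + 2)%N; last by rewrite addn2.
  rewrite (perm_size pt) /A !size_cat !size_map -bz addnA.
  have sz (l : seq (option C * nat)) : size l = size (unzip2 l) by rewrite size_map.
  by rewrite !sz (perm_size p0) (perm_size p1) (perm_size poo).
have ut : uniq (unzip1 t) by rewrite (perm_uniq (perm_map _ pt)).
have vt u : u \in t -> has_point f u.1 u.2 by rewrite (perm_mem pt); exact: vA.
case: t pt st t2 ut vt => [|a [|o [|x t]]] // _ _ t2 ut vt.
have [a2 o2 x2] : [/\ a.2 = at0 mk, o.2 = atoo mk &
    forall p, at1 mk = Some p -> x.2 = p].
  by case: t2 => -> ->; case: (at1 mk) => [p|] //= [-> _]; split=> // q [].
have [m [mm ma mx mo]] : exists m : option C -> option C,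
  [/\ moebius_map m, m (Some 0) = a.1, m (Some 1) = x.1 & m None = o.1].
  move: ut; rewrite /= !inE !negb_or => /and4P[/and3P[ao ax _] /andP[ox _] _ _].
  by apply: exists_moebius; rewrite // eq_sym.
have [g [gd gE]] := moebius_precomp fd0 mm; exists m, g; split=> //.
- by move=> y; case: (gE y).
- split; first by rewrite gd.
    by move=> y; have [-> ->] := gE y; exact: fram.
  move=> z; apply: (fiber_orders_transport (m' := id) (moebius_map_bij mm) _ gE) => //.
- split.
  + have [g1 g2] := gE (Some 0); rewrite /has_point g1 g2 ma -a2.
    by apply: vt; rewrite mem_head.
  + move=> p /x2 <-; have [g1 g2] := gE (Some 1); rewrite /has_point g1 g2 mx.
    by apply: vt; rewrite !inE eqxx !orbT.
  + have [g1 g2] := gE None; rewrite /has_point g1 g2 mo -o2.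
    by apply: vt; rewrite !inE eqxx !orbT.
Qed.

Lemma exists_choice (d : nat) (c : 'I_3 -> seq nat) :
    (forall i, 0%N \notin c i) -> (forall i, sumn (c i) = d) ->
    (\sum_(i < 3) size (c i) = d + 2)%N ->
    (exists i, two_or_one_pattern (c i)) ->
  exists (s : Delta -> 'I_3) (mk : marking),
      injective s /\ admissible (c \o s) mk.
Proof.
move=> c0 cs cz [i ci].
(* A cyclic relabelling that puts the collection number [i] above 1. *)
pose s (z : Delta) : 'I_3 :=
  i + (if z is Some x then if x then 0 else 1 else 1 + 1).
have si : injective s.
  by move=> [[]|] [[]|] // /addrI /(congr1 val).
have sz1 : s z1 = i by rewrite /s addr0.
have dgt0 : (0 < d)%N.
  apply: (@degree_gt0 d (c \o s)) => [z|z|]; [exact: c0 | exact: cs |].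
  by rewrite -cz (sum_reindex_Delta _ si).
have hd z : head 0%N (c (s z)) \in c (s z).
  by move: dgt0; rewrite -(cs (s z)); case: (c (s z)) => //= k l _; exact: mem_head.
(* Some point above 0 becomes [x = 0]; infinity is the simple point above 1 if there is one, and a
   point above [oo] otherwise. The two lie in different fibers, so each needs only one occurrence in
   the pattern. *)
pose p0 : point := (z0, head 0%N (c (s z0))).
pose poo : point := if 1%N \in c i then (z1, 1%N) else (zoo, head 0%N (c (s zoo))).
have m0 : p0 \in pattern_points (c \o s) by rewrite mem_pattern_points; exact: hd.
have moo : poo \in pattern_points (c \o s).
  rewrite mem_pattern_points /poo; case: ifP => [c1|_] /=; last exact: hd.
  by rewrite sz1.
exists s, (Marking p0 None poo); split=> //; split=> /=.
- by rewrite sz1.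
- have n0 : p0 != poo by rewrite /p0 /poo; case: ifP.
  move=> p; case: (p0 =P p) => [<-|_].
    by rewrite eq_sym (negPf n0) addn0 -has_count has_pred1.
  by case: (poo =P p) => [<-|_] //; rewrite -has_count has_pred1.
- by rewrite sz1 /poo => ->.
Qed.

Theorem mainTheorem7 (C : numClosedFieldType) (d : nat) (c : 'I_3 -> seq nat)
    (c_gt0 : forall i, 0%N \notin c i)
    (c_sum : forall i, sumn (c i) = d)
    (c_size : (\sum_(i < 3) size (c i) = d + 2)%N)
    (c_two : exists i, two_or_one_pattern (c i)) :
  (* Step 1 can be carried out *)
  (exists (s : Delta -> 'I_3) (mk : marking),
      injective s /\ admissible (c \o s) mk) /\
  (* whatever the choices made in Step 1 *)
  (forall (s : Delta -> 'I_3) (mk : marking),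
      injective s -> admissible (c \o s) mk ->
    [/\ (* Step 2: R is the numerator of phi'/phi *)
        forall v : 'I_(size (unknown_points (c \o s) mk)) -> C,
          nondegenerate_coefs v ->
          forall K, K != 0 ->
          is_numerator (fderiv (phi v K) / phi v K) (polR v),
        (* Steps 3 and 4, for a nondegenerate solution *)
        forall v : 'I_(size (unknown_points (c \o s) mk)) -> C,
          solution v -> nondegenerate_coefs v ->
          [/\ is_numerator (fderiv (phi_tilde v) / phi_tilde v) (polN v),
              forall a, mup a (polN v) = (mup a (polP v)).-1,
              (exists! K, proportional (1 - phi v K) (phi_tilde v))
            & forall K, proportional (1 - phi v K) (phi_tilde v) ->
              forall a, root (polR v) a <->
                feval (phi v K) (Some a) = pt C z1
                /\ (1 < ramidx (phi v K) (Some a))%N],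
        (* the output consists of the normalized Belyi functions with the     *)
        (* prescribed branching orders                                        *)
        forall f : {fraction {poly C}},
          output (c \o s) mk f <->
          belyi_with_orders d (c \o s) f /\ respects_marking mk f
      & (* every Belyi function with the given branching orders, in whatever  *)
        (* order of the fibers, is obtained from an output function by        *)
        (* fractional-linear transformations                                  *)
        forall (f : {fraction {poly C}}) (s' : Delta -> 'I_3),
          injective s' -> belyi_with_orders d (c \o s') f ->
          exists mu nu g : {fraction {poly C}},
            [/\ mobius mu, mobius nu, output (c \o s) mk g,
                forall x, feval g x = feval nu (feval f (feval mu x))
              & forall z z', s' z = s z' -> feval nu (pt C z) = pt C z']]).
Proof.
split; first exact: exists_choice c_gt0 c_sum c_size c_two.
move=> s mk s_inj adm.
have b0 z : 0%N \notin (c \o s) z by exact: c_gt0.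
have bs z : sumn ((c \o s) z) = d by exact: c_sum.
have bz : (size ((c \o s) z0) + size ((c \o s) z1) + size ((c \o s) zoo) = d + 2)%N.
  by rewrite -c_size (sum_reindex_Delta _ s_inj).
have dgt0 := degree_gt0 b0 bs bz.
have outE f : output (c \o s) mk f <->
    belyi_with_orders d (c \o s) f /\ respects_marking mk f.
  split=> [[v [K [sol nd /(proportionalE b0 adm)[a a0 Ka] ->]]]|[]].
    exact: (phi_belyi b0 bs bz adm nd sol a0 Ka).
  exact: belyi_output.
split=> //.
- by move=> v nd K K0; exact: polR_numerator.
- move=> v sol nd; split.
  + exact: polN_numerator nd sol.
  + exact: mup_polN nd sol.
  + exact: proportional_uniq nd sol.
  + move=> K /(proportionalE b0 adm)[a a0 Ka]; exact: root_polRE a0 Ka.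
- move=> f s' s'_inj fb; have [fd fram fo] := fb.
  have [si sK siK] := Delta_bij s_inj; have [s'i s'K s'iK] := Delta_bij s'_inj.
  (* The permutation [sg] translates the fiber order [s'] into [s]; [nuM] below realizes it by a
     transformation of the lower line that permutes 0, 1 and infinity. *)
  pose sg z := si (s' z); have s_sg z : s (sg z) = s' z by exact: siK.
  have sg_inj : injective sg by apply: inj_comp => //; exact: can_inj siK.
  have pts z z' : z != z' -> pt C (sg z) != pt C (sg z').
    by rewrite (inj_eq (@pt_inj C)) (inj_eq sg_inj).
  have [nuM [nm nu0 nu1 nuoo]] := exists_moebius (pts z0 z1 isT) (pts z0 zoo isT) (pts z1 zoo isT).
  have nuE z : nuM (pt C z) = pt C (sg z) by case: z => [[]|].
  have fd0 : (0 < fdeg f)%N by rewrite fd.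
  have [h [hd hE]] := moebius_postcomp fd0 nm.
  have hb : belyi_with_orders d (c \o s) h.
    split; first by rewrite hd.
      move=> x; have [-> ->] := hE x => /fram[z ->]; exists (sg z); exact: nuE.
    move=> z; have -> : z = sg (s'i (s z)) by rewrite /sg s'iK sK.
    rewrite -nuE; apply: (fiber_orders_transport (m := id) _ _ hE) => //.
    - by exists id.
    - exact: bij_inj (moebius_map_bij nm).
    - by rewrite /= s_sg; exact: fo.
  have mk_ok : forall p, (count_mem p (marked mk) <=
     count_mem p (pattern_points (c \o s)))%N by case: adm.
  have [muM [g [mm gE gb gm]]] := belyi_moebius dgt0 bz mk_ok hb.
  have [mu [mu1 muE]] := moebius_frac mm; have [nu [nu1' nuF]] := moebius_frac nm.
  exists mu, nu, g; split=> //.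
  + by apply/outE.
  + by move=> x; rewrite gE (proj1 (hE _)) muE nuF.
  + by move=> z z' zz; rewrite nuF nuE /sg zz sK.
Qed.
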